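(* Let $L$ be a countable signature of continuous logic, let $F$ be a fragment of the infinitary continuous logic $\mathcal{L}_{\omega_1\omega}(L)$, and let $T$ be an $F$-theory all of whose models are almost locally compact. Then the isomorphism relation $\cong_T$ on $\mathrm{Mod}(T)$ is classifiable by countable structures.
   Context: A Polish metric structure in signature $L$ is a complete separable metric space $(M,d)$ (with bounded metric) together with interpretations of the predicate symbols of $L$ as uniformly continuous real-valued functions with the moduli prescribed by $L$. As in the paper, fragments are countable. $\mathrm{Mod}(L)$ denotes the standard Borel space of codes of Polish metric structures: a code describes the values of $d$ and of all predicates on tuples from $\mathbb{N}$, where $\mathbb{N}$ is a tail-dense subset of the structure (every tail $\{n,n+1,\dots\}$ is dense); the coded structure is the completion. An $F$-theory $T$ is a set of $F$-sentences, and $\mathrm{Mod}(T)\subseteq \mathrm{Mod}(L)$ is the set of codes of structures in which every sentence of $T$ takes value $0$. For $M,N\in\mathrm{Mod}(T)$, $M\cong_T N$ iff the coded structures are isomorphic (there is a surjective isometry preserving all predicates). A topological space is almost locally compact if it contains a dense locally compact subspace. An equivalence relation $E$ on a standard Borel space $X$ is classifiable by countable structures if there are a countable relational language $L'$ and a Borel map $f$ from $X$ into the standard Borel space of $L'$-structures with universe $\mathbb{N}$ such that $xEy$ iff $f(x)\cong f(y)$. *)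

(* Defs.v *)
From Stdlib Require Import Reals.
From Stdlib Require Vectors.Fin.
From Coquelicot Require Import Coquelicot.
Open Scope R_scope.

Record signature := {
  Pred : Type;
  pred_code : Pred -> nat;
  pred_code_inj : forall p q, pred_code p = pred_code q -> p = q;
  arity : Pred -> nat;
  modulus : Pred -> R -> R;
  modulus_pos : forall P e, 0 < e -> 0 < modulus P e;
  pbound : Pred -> R;
  dbound : R }.

Record structure (L : signature) := {
  carrier :> Type;
  dist : carrier -> carrier -> R;
  interp : forall P : Pred L, (Fin.t (arity L P) -> carrier) -> R }.
Arguments dist {L} _ _ _.
Arguments interp {L} _ _ _.

Definition cauchy {L} (M : structure L) (u : nat -> M) : Prop :=
  forall e, 0 < e -> exists N, forall n m, (N <= n)%nat -> (N <= m)%nat ->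
    dist M (u n) (u m) < e.

Definition converges_to {L} (M : structure L) (u : nat -> M) (x : M) : Prop :=
  forall e, 0 < e -> exists N, forall n, (N <= n)%nat -> dist M (u n) x < e.

Definition polish {L} (M : structure L) : Prop :=
  (forall x y, 0 <= dist M x y) /\
  (forall x y, dist M x y = 0 <-> x = y) /\
  (forall x y, dist M x y = dist M y x) /\
  (forall x y z, dist M x z <= dist M x y + dist M y z) /\
  (forall x y, dist M x y <= dbound L) /\
  (forall u : nat -> M, cauchy M u -> exists x, converges_to M u x) /\
  (exists s : nat -> M, forall x e, 0 < e -> exists n, dist M (s n) x < e) /\
  (forall P a, Rabs (interp M P a) <= pbound L P) /\
  (forall P e (a b : Fin.t (arity L P) -> M), 0 < e ->
     (forall k, dist M (a k) (b k) < modulus L P e) ->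
     Rabs (interp M P a - interp M P b) <= e).

Definition isomorphic {L} (M N : structure L) : Prop :=
  exists g : M -> N,
    (forall y : N, exists x : M, g x = y) /\
    (forall x y, dist N (g x) (g y) = dist M x y) /\
    (forall P (a : Fin.t (arity L P) -> M),
       interp N P (fun k => g (a k)) = interp M P a).

Inductive formula (L : signature) : Type :=
| F_dist : nat -> nat -> formula L
| F_pred : forall P : Pred L, (Fin.t (arity L P) -> nat) -> formula L
| F_conn : forall n : nat, ((Fin.t n -> R) -> R) -> (Fin.t n -> formula L) -> formula L
| F_sup : nat -> formula L -> formula L
| F_inf : nat -> formula L -> formula L
| F_bigsup : (nat -> formula L) -> formula L
| F_biginf : (nat -> formula L) -> formula L.
Arguments F_dist {L}. Arguments F_pred {L}. Arguments F_conn {L}.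
Arguments F_sup {L}. Arguments F_inf {L}.
Arguments F_bigsup {L}. Arguments F_biginf {L}.

Definition upd {A : Type} (s : nat -> A) (i : nat) (a : A) : nat -> A :=
  fun j => if Nat.eqb j i then a else s j.

Definition rsup (E : R -> Prop) : R := real (Lub_Rbar E).
Definition rinf (E : R -> Prop) : R := real (Glb_Rbar E).

Fixpoint eval {L} (M : structure L) (s : nat -> M) (phi : formula L) : R :=
  match phi with
  | F_dist i j => dist M (s i) (s j)
  | F_pred P v => interp M P (fun k => s (v k))
  | F_conn n u ps => u (fun k => eval M s (ps k))
  | F_sup i p => rsup (fun r => exists m : M, r = eval M (upd s i m) p)
  | F_inf i p => rinf (fun r => exists m : M, r = eval M (upd s i m) p)
  | F_bigsup ps => rsup (fun r => exists n, r = eval M s (ps n))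
  | F_biginf ps => rinf (fun r => exists n, r = eval M s (ps n))
  end.

Inductive free {L} : formula L -> nat -> Prop :=
| fv_dist_l i j : free (F_dist i j) i
| fv_dist_r i j : free (F_dist i j) j
| fv_pred P v k : free (F_pred P v) (v k)
| fv_conn n u ps k x : free (ps k) x -> free (F_conn n u ps) x
| fv_sup i p x : free p x -> x <> i -> free (F_sup i p) x
| fv_inf i p x : free p x -> x <> i -> free (F_inf i p) x
| fv_bigsup ps n x : free (ps n) x -> free (F_bigsup ps) x
| fv_biginf ps n x : free (ps n) x -> free (F_biginf ps) x.

Definition sentence {L} (phi : formula L) : Prop := forall x, ~ free phi x.

Definition continuous_conn (n : nat) (u : (Fin.t n -> R) -> R) : Prop :=
  forall v e, 0 < e -> exists d, 0 < d /\
    forall w, (forall k, Rabs (v k - w k) < d) -> Rabs (u v - u w) < e.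

Definition admissible_family {L} (ps : nat -> formula L) : Prop :=
  (exists K, forall n x, free (ps n) x -> (x < K)%nat) /\
  (exists b, forall (M : structure L) s n, polish M -> Rabs (eval M s (ps n)) <= b) /\
  (exists D : R -> R, (forall e, 0 < e -> 0 < D e) /\
     forall (M : structure L) s t n e, polish M -> 0 < e ->
       (forall x, dist M (s x) (t x) < D e) ->
       Rabs (eval M s (ps n) - eval M t (ps n)) <= e).

Inductive wf {L} : formula L -> Prop :=
| wf_dist i j : wf (F_dist i j)
| wf_pred P v : wf (F_pred P v)
| wf_conn n u ps : continuous_conn n u -> (forall k, wf (ps k)) -> wf (F_conn n u ps)
| wf_sup i p : wf p -> wf (F_sup i p)
| wf_inf i p : wf p -> wf (F_inf i p)
| wf_bigsup ps : (forall n, wf (ps n)) -> admissible_family ps -> wf (F_bigsup ps)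
| wf_biginf ps : (forall n, wf (ps n)) -> admissible_family ps -> wf (F_biginf ps).

Inductive immsub {L} : formula L -> formula L -> Prop :=
| is_conn n u ps k : immsub (ps k) (F_conn n u ps)
| is_sup i p : immsub p (F_sup i p)
| is_inf i p : immsub p (F_inf i p)
| is_bigsup ps n : immsub (ps n) (F_bigsup ps)
| is_biginf ps n : immsub (ps n) (F_biginf ps).

Definition fragment {L} (F : formula L -> Prop) : Prop :=
  (exists e : nat -> formula L, forall phi, F phi -> exists n, e n = phi) /\
  (forall phi, F phi -> wf phi) /\
  (forall i j, F (F_dist i j)) /\
  (forall P v, F (F_pred P v)) /\
  (forall phi psi, F psi -> immsub phi psi -> F phi) /\
  (forall i phi, F phi -> F (F_sup i phi) /\ F (F_inf i phi)).

Definition F_theory {L} (F T : formula L -> Prop) : Prop :=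
  forall phi, T phi -> F phi /\ sentence phi.

Definition models {L} (M : structure L) (T : formula L -> Prop) : Prop :=
  polish M /\ forall phi s, T phi -> eval M s phi = 0.

Definition open_set {L} (M : structure L) (U : M -> Prop) : Prop :=
  forall x, U x -> exists e, 0 < e /\ forall y, dist M x y < e -> U y.

Definition compact_set {L} (M : structure L) (K : M -> Prop) : Prop :=
  forall (I : Type) (U : I -> M -> Prop), (forall i, open_set M (U i)) ->
    (forall x, K x -> exists i, U i x) ->
    exists l : list I, forall x, K x -> exists i, List.In i l /\ U i x.

Definition dense_set {L} (M : structure L) (D : M -> Prop) : Prop :=
  forall x e, 0 < e -> exists y, D y /\ dist M x y < e.

Definition locally_compact_sub {L} (M : structure L) (D : M -> Prop) : Prop :=
  forall x, D x -> exists K e, 0 < e /\ compact_set M K /\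
    (forall y, K y -> D y) /\ (forall y, D y -> dist M x y < e -> K y).

Definition almost_locally_compact {L} (M : structure L) : Prop :=
  exists D, dense_set M D /\ locally_compact_sub M D.

Definition Code (L : signature) : Type :=
  ((nat -> nat -> R) * (forall P : Pred L, (Fin.t (arity L P) -> nat) -> R))%type.

Definition codes {L} (c : Code L) (M : structure L) (a : nat -> M) : Prop :=
  polish M /\
  (forall n x e, 0 < e -> exists m, (n <= m)%nat /\ dist M (a m) x < e) /\
  (forall i j, fst c i j = dist M (a i) (a j)) /\
  (forall P v, snd c P v = interp M P (fun k => a (v k))).

Definition ModT {L} (T : formula L -> Prop) (c : Code L) : Prop :=
  exists (M : structure L) a, codes c M a /\ models M T.

Definition isoT {L} (c c' : Code L) : Prop :=
  exists (M M' : structure L) a a', codes c M a /\ codes c' M' a' /\ isomorphic M M'.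

Inductive sigma_gen {X : Type} (G : (X -> Prop) -> Prop) : (X -> Prop) -> Prop :=
| sg_gen A : G A -> sigma_gen G A
| sg_compl A : sigma_gen G A -> sigma_gen G (fun x => ~ A x)
| sg_union (A : nat -> X -> Prop) : (forall n, sigma_gen G (A n)) ->
    sigma_gen G (fun x => exists n, A n x)
| sg_ext A B : sigma_gen G A -> (forall x, A x <-> B x) -> sigma_gen G B.

Definition code_borel {L} : (Code L -> Prop) -> Prop :=
  sigma_gen (fun A =>
    (exists i j r, forall c, A c <-> fst c i j < r) \/
    (exists P v r, forall c, A c <-> snd c P v < r)).

Record rel_language := {
  Sym : Type;
  sym_code : Sym -> nat;
  sym_code_inj : forall p q, sym_code p = sym_code q -> p = q;
  sarity : Sym -> nat }.

Definition cstructure (L' : rel_language) : Type :=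
  forall s : Sym L', (Fin.t (sarity L' s) -> nat) -> bool.

Definition cstructure_borel {L'} : (cstructure L' -> Prop) -> Prop :=
  sigma_gen (fun A => exists s v, forall x, A x <-> x s v = true).

Definition ciso {L'} (x y : cstructure L') : Prop :=
  exists (p q : nat -> nat), (forall n, q (p n) = n) /\ (forall n, p (q n) = n) /\
    forall s v, y s (fun k => p (v k)) = x s v.

Definition classifiable_by_countable_structures {L}
    (X : Code L -> Prop) (E : Code L -> Code L -> Prop) : Prop :=
  exists (L' : rel_language) (f : Code L -> cstructure L'),
    (forall B, cstructure_borel B ->
       exists A, code_borel A /\ forall c, X c -> (B (f c) <-> A c)) /\
    (forall c c', X c -> X c' -> (E c c' <-> ciso (f c) (f c'))).

(* Main.v *)
(** A piece is a class of tuples of [M] satisfying the open conditions recorded in a list of labels,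
    two tuples being equivalent when a chain of small steps inside the set joins them.  Pieces are
    open and canonically attached to [M], only countably many exist for each list of labels, and
    they can be computed from any dense sequence; the classifying structure is the tree of pieces.

    Conversely, an isomorphism of two trees is a back-and-forth system between pieces.  The danger
    is that, along a branch, the pieces on one side drift away to infinity, since a piece need not
    be relatively compact.  This is where almost local compactness enters: a label may bound the
    number of separated points that a piece has in a totally bounded ball, and below a piece where
    this bound is least possible the projections of all descendants stay dense up to the chosen
    scale.  Hence tuples can be chosen convergent on both sides of a generic branch, and their
    limits are dense sequences with the same distances and predicate values. *)

From Stdlib Require Import Reals Lra Lia List ZArith Cantor FinFun Relations.
From Stdlib Require Import Classical ClassicalEpsilon FunctionalExtensionality.
From Coquelicot Require Import Hierarchy.
Require Import Defs.
Import ListNotations.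
Open Scope R_scope.

(** * Preliminaries *)

Definition eps (n : nat) : R := (/ 2) ^ n.

Lemma eps_pos n : 0 < eps n.
Proof. apply pow_lt; lra. Qed.

Lemma eps_S n : eps (S n) = eps n / 2.
Proof. unfold eps; simpl; lra. Qed.

Lemma eps_le n m : (n <= m)%nat -> eps m <= eps n.
Proof.
  induction 1 as [|m _ IH]; [lra|].
  rewrite eps_S; pose proof (eps_pos m); lra.
Qed.

Lemma eventually_eps_lt r : 0 < r -> eventually (fun n => eps n < r).
Proof.
  intros Hr; destruct (pow_lt_1_zero (/ 2)) with (y := r) as [N HN]; [|exact Hr|].
  - rewrite Rabs_pos_eq; lra.
  - exists N; intros n Hn; specialize (HN n Hn).
    rewrite Rabs_pos_eq in HN; [exact HN|apply Rlt_le, eps_pos].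
Qed.

Lemma exists_eps_lt r : 0 < r -> exists n, eps n < r.
Proof. intros Hr; apply filter_ex, eventually_eps_lt, Hr. Qed.

Lemma eventually_ge N : eventually (fun n => (N <= n)%nat).
Proof. now exists N. Qed.

Lemma eventually_and_ex (P Q : nat -> Prop) :
  eventually P -> eventually Q -> exists n, P n /\ Q n.
Proof. intros HP HQ; apply (filter_ex (F := eventually)); now apply filter_and. Qed.

Lemma eventually_Forall2 {A B} (P : nat -> A -> B -> Prop) l l' :
  Forall2 (fun a b => eventually (fun n => P n a b)) l l' ->
  eventually (fun n => Forall2 (P n) l l').
Proof.
  induction 1 as [|a b l l' Hab _ IH]; [now exists O|].
  apply filter_imp with (2 := filter_and _ _ Hab IH); intros n []; now constructor.
Qed.

Lemma Forall2_sym {A} (R : relation A) l l' :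
  symmetric A R -> Forall2 R l l' -> Forall2 R l' l.
Proof. intros HR; induction 1; constructor; auto. Qed.

Lemma Forall2_firstn {A B} (R : A -> B -> Prop) n l l' :
  Forall2 R l l' -> Forall2 R (firstn n l) (firstn n l').
Proof. intros Hll; revert n; induction Hll; intros [|n]; simpl; auto. Qed.

Lemma Forall2_nth {A B} (R : A -> B -> Prop) l l' i d d' :
  Forall2 R l l' -> R d d' -> R (nth i l d) (nth i l' d').
Proof. intros Hll Hd; revert i; induction Hll; intros [|i]; simpl; auto. Qed.

Lemma Forall2_ex {A B} (P : A -> Prop) (R : A -> B -> Prop) l :
  (forall a, P a -> exists b, R a b) -> Forall P l -> exists l', Forall2 R l l'.
Proof.
  intros HR; induction 1 as [|a l Ha _ [l' IH]]; [now exists []|].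
  destruct (HR a Ha) as [b Hb]; exists (b :: l'); now constructor.
Qed.

Lemma Forall2_In_l {A B} (R : A -> B -> Prop) l l' a :
  Forall2 R l l' -> In a l -> exists b, In b l' /\ R a b.
Proof.
  induction 1 as [|a0 b0 l l' Hab _ IH]; intros Ha; [easy|].
  destruct Ha as [->|Ha]; [exists b0; simpl; auto|].
  destruct (IH Ha) as [b [Hb HR]]; exists b; simpl; auto.
Qed.

Lemma ForallOrdPairs_impl {A} (P Q : A -> A -> Prop) l :
  (forall a b, P a b -> Q a b) -> ForallOrdPairs P l -> ForallOrdPairs Q l.
Proof.
  intros HPQ; induction 1 as [|a l Ha _ IH]; constructor; [|easy].
  apply Forall_impl with (2 := Ha), HPQ.
Qed.

Lemma ForallOrdPairs_Forall2 {A B} (P : A -> A -> Prop) (Q : B -> B -> Prop)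
    (R : A -> B -> Prop) l l' :
  (forall a a' b b', R a b -> R a' b' -> P a a' -> Q b b') ->
  Forall2 R l l' -> ForallOrdPairs P l -> ForallOrdPairs Q l'.
Proof.
  intros HPQ; induction 1 as [|a b l l' Hab Hl IH]; intros HP; [constructor|].
  inversion_clear HP as [|? ? Ha HP']; constructor; [clear IH HP'|auto].
  induction Hl; inversion_clear Ha; constructor; eauto.
Qed.

Lemma nth_firstn_indep {A} k (l : list A) i d d' :
  (i < k)%nat -> (i < length l)%nat -> nth i (firstn k l) d = nth i l d'.
Proof.
  intros Hk Hl; apply Nat.ltb_lt in Hk; rewrite nth_firstn, Hk; now apply nth_indep.
Qed.

Lemma clos_refl_trans_sym {A} (R : relation A) :
  symmetric A R -> symmetric A (clos_refl_trans A R).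
Proof.
  intros HR x y; induction 1 as [x y Hxy| |x y z _ IHxy _ IHyz].
  - now apply rt_step, HR.
  - apply rt_refl.
  - now apply rt_trans with y.
Qed.

Definition suffix {A} (l l' : list A) : Prop := exists k, l' = k ++ l.

Lemma suffix_refl {A} (l : list A) : suffix l l.
Proof. now exists []. Qed.

Lemma suffix_cons {A} (a : A) l : suffix l (a :: l).
Proof. now exists [a]. Qed.

Lemma suffix_trans {A} (l l' l'' : list A) : suffix l l' -> suffix l' l'' -> suffix l l''.
Proof. intros [k ->] [k' ->]; exists (k' ++ k); apply app_assoc. Qed.

Lemma suffix_length {A} (l l' : list A) : suffix l l' -> (length l <= length l')%nat.
Proof. intros [k ->]; rewrite length_app; lia. Qed.

Lemma pigeonhole {A B} (R : A -> B -> Prop) l k :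
  Forall (fun a => exists b, In b k /\ R a b) l ->
  ForallOrdPairs (fun a a' => ~ exists b, R a b /\ R a' b) l ->
  (length l <= length k)%nat.
Proof.
  intros Hk Hsep.
  destruct (Forall2_ex _ (fun a b => In b k /\ R a b) l (fun _ Ha => Ha) Hk) as [l' Hl'].
  rewrite (Forall2_length Hl'); apply NoDup_incl_length.
  - apply NoDup_iff_ForallOrdPairs; revert Hl' Hsep; apply ForallOrdPairs_Forall2.
    intros a a' b b' [_ Hb] [_ Hb'] Hn <-; apply Hn; now exists b.
  - intros b Hb; apply Forall2_flip in Hl'.
    now destruct (Forall2_In_l _ _ _ _ Hl' Hb) as (a & _ & ? & _).
Qed.

Lemma dependent_choice {A} (P : nat -> A -> Prop) (R : nat -> A -> A -> Prop) :
  (exists a, P O a) ->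
  (forall n a, P n a -> exists b, P (S n) b /\ R n a b) ->
  exists s : nat -> A, forall n, P n (s n) /\ R n (s n) (s (S n)).
Proof.
  intros [a0 Ha0] Hstep.
  destruct (choice (fun (na : nat * A) b => P (fst na) (snd na) ->
    P (S (fst na)) b /\ R (fst na) (snd na) b)) as [next Hnext].
  { intros [n a]; destruct (classic (P n a)) as [Ha|Ha]; [|now exists a].
    destruct (Hstep n a Ha) as [b Hb]; now exists b. }
  exists (nat_rect (fun _ => A) a0 (fun n a => next (n, a))).
  assert (HP : forall n, P n (nat_rect (fun _ => A) a0 (fun n a => next (n, a)) n)).
  { induction n as [|n IH]; [exact Ha0|exact (proj1 (Hnext (n, _) IH))]. }
  intros n; split; [apply HP|exact (proj2 (Hnext (n, _) (HP n)))].
Qed.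

Lemma Cantor_Bernstein_within {A B} (R : A -> B -> Prop) (f : A -> B) (g : B -> A) :
  Injective f -> Injective g -> (forall a, R a (f a)) -> (forall b, R (g b) b) ->
  exists h : A -> B, Bijective h /\ forall a, R a (h a).
Proof.
  intros If Ig Rf Rg.
  set (C := clos_refl_trans A (fun a a' => a' = g (f a))).
  set (orphaned := fun a => exists a0, C a0 a /\ forall b, g b <> a0).
  assert (Hparent : forall b, orphaned (g b) -> exists a, orphaned a /\ f a = b).
  { intros b (a0 & HC & Ha0); apply clos_rt_rtn1 in HC; inversion HC as [E|a ? E HC' E'].
    - now destruct (Ha0 b).
    - exists a; split; [exists a0; split; [now apply clos_rtn1_rt|easy]|now apply Ig]. }
  assert (Hchild : forall a, orphaned a -> orphaned (g (f a))).
  { intros a (a0 & HC & Ha0); exists a0; split; [|easy].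
    apply rt_trans with a; [easy|now apply rt_step]. }
  destruct (choice (fun a b => (orphaned a /\ b = f a) \/ (~ orphaned a /\ g b = a)))
    as [h Hh].
  { intros a; destruct (classic (orphaned a)) as [Ha|Ha]; [exists (f a); auto|].
    destruct (classic (exists b, g b = a)) as [[b Hb]|Hb]; [exists b; auto|].
    exfalso; apply Ha; exists a; split; [apply rt_refl|intros b E; apply Hb; now exists b]. }
  assert (Hsurj : forall b, exists a, h a = b).
  { intros b; destruct (classic (orphaned (g b))) as [Ho|Ho].
    - destruct (Hparent b Ho) as [a [Ha <-]]; exists a; now destruct (Hh a) as [[_ ?]|[]].
    - exists (g b); destruct (Hh (g b)) as [[]|[_ E]]; [easy|now apply Ig]. }
  assert (Hinj : Injective h).
  { intros a a' E; destruct (Hh a) as [[Ha Ea]|[Ha Ea]], (Hh a') as [[Ha' Ea']|[Ha' Ea']].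
    - apply If; congruence.
    - destruct Ha'; rewrite <- Ea', <- E, Ea; auto.
    - destruct Ha; rewrite <- Ea, E, Ea'; auto.
    - congruence. }
  exists h; split.
  - destruct (choice _ Hsurj) as [h' Hh']; exists h'; auto.
  - intros a; destruct (Hh a) as [[_ ->]|[_ E]]; [apply Rf|rewrite <- E at 1; apply Rg].
Qed.

(** * Countability *)

Definition countable (A : Type) : Prop := exists code : A -> nat, Injective code.

Lemma countable_inj {A B} (f : A -> B) : Injective f -> countable B -> countable A.
Proof. intros Hf [code Hcode]; exists (fun a => code (f a)); intros a a' E; auto. Qed.

Lemma countable_nat : countable nat.
Proof. now exists (fun n => n). Qed.

Lemma countable_prod {A B} : countable A -> countable B -> countable (A * B).
Proof.
  intros [f Hf] [g Hg]; exists (fun p => to_nat (f (fst p), g (snd p))).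
  intros [a b] [a' b'] E; apply to_nat_inj in E; injection E; intros; f_equal; auto.
Qed.

Lemma countable_sum {A B} : countable A -> countable B -> countable (A + B).
Proof.
  intros [f Hf] [g Hg].
  exists (fun c => match c with inl a => to_nat (0, f a) | inr b => to_nat (1, g b) end%nat).
  intros [a|b] [a'|b'] E; apply to_nat_inj in E; try discriminate E;
    injection E as E; f_equal; auto.
Qed.

Lemma countable_sigT {A} (B : A -> Type) :
  countable A -> (forall a, countable (B a)) -> countable {a : A & B a}.
Proof.
  intros [f Hf] HB.
  set (g := fun a => proj1_sig (constructive_indefinite_description _ (HB a))).
  exists (fun p => to_nat (f (projT1 p), g _ (projT2 p))).
  intros [a b] [a' b'] E; apply to_nat_inj in E; simpl in E; injection E as Ea Eb.
  apply Hf in Ea; subst a'; f_equal.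
  exact (proj2_sig (constructive_indefinite_description _ (HB a)) b b' Eb).
Qed.

Lemma countable_option {A} : countable A -> countable (option A).
Proof.
  intros [f Hf]; exists (fun o => match o with Some a => S (f a) | None => O end).
  intros [a|] [a'|] E; try easy; f_equal; auto.
Qed.

Lemma countable_list {A} : countable A -> countable (list A).
Proof.
  intros [f Hf].
  exists (fix code l := match l with [] => O | a :: l => S (to_nat (f a, code l)) end).
  intros l; induction l as [|a l IH]; intros [|a' l'] E; try easy.
  apply eq_add_S, to_nat_inj in E; injection E as Ea El; f_equal; auto.
Qed.

Lemma countable_Z : countable Z.
Proof.
  apply (@countable_inj _ (nat * nat) (fun z => (Z.to_nat z, Z.to_nat (- z)))).
  - intros z z' E; injection E; lia.
  - auto using countable_prod, countable_nat.
Qed.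

Lemma countable_fin_function n {A} : countable A -> countable (Fin.t n -> A).
Proof.
  intros HA; induction n as [|n IH].
  - exists (fun _ => O); intros v w _; extensionality k; inversion k.
  - apply (@countable_inj _ (A * (Fin.t n -> A)) (fun v => (v Fin.F1, fun k => v (Fin.FS k)))).
    + intros v w E; injection E as E1 ES; extensionality k.
      apply (Fin.caseS' k); [exact E1|exact (fun k' => f_equal (fun u => u k') ES)].
    + now apply countable_prod.
Qed.

(* Each element gets infinitely many indices, and the argument [k] can be read off the index. *)
Record enumeration (A : Type) : Type := {
  enum : nat -> A;
  index : A -> nat -> nat;
  enum_index : forall a k, enum (index a k) = a;
  index_inj : forall a b j k, index a j = index b k -> j = k;
  index_ge : forall a k, (k <= index a k)%nat }.
Arguments enum {A}.
Arguments index {A}.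
Arguments enum_index {A}.

Lemma countable_enumeration {A} (a0 : A) : countable A -> enumeration A.
Proof.
  intros HA; destruct (constructive_indefinite_description _ HA) as [code Hcode].
  refine {| enum := fun m => epsilon (inhabits a0) (fun a => code a = fst (of_nat m));
    index := fun a k => to_nat (code a, k) |}.
  - intros a k; rewrite cancel_of_to; apply Hcode.
    apply (epsilon_spec (inhabits a0) (fun a' => code a' = code a)); now exists a.
  - intros a b j k E; apply to_nat_inj in E; congruence.
  - intros a k; pose proof (to_nat_non_decreasing (code a) k); lia.
Qed.

(** * Prestructures and tuples *)

Class prestructure {L} (M : structure L) : Prop := {
  dist_refl : forall x : M, dist M x x = 0;
  dist_sym : forall x y : M, dist M x y = dist M y x;
  dist_triangle : forall x y z : M, dist M x z <= dist M x y + dist M y z;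
  interp_continuous : forall P e (a b : Fin.t (arity L P) -> M), 0 < e ->
    (forall k, dist M (a k) (b k) < modulus L P e) ->
    Rabs (interp M P a - interp M P b) <= e }.

Existing Class polish.

#[local] Instance polish_prestructure {L} (M : structure L) : polish M -> prestructure M.
Proof.
  intros (_ & Hsep & Hsym & Htri & _ & _ & _ & _ & Hcont); split; auto.
  intros x; now apply Hsep.
Qed.

Lemma polish_complete {L} (M : structure L) (u : nat -> M) :
  polish M -> cauchy M u -> exists x, converges_to M u x.
Proof. intros (_ & _ & _ & _ & _ & Hcomplete & _); apply Hcomplete. Qed.

Inductive atom (L : signature) (I : Type) : Type :=
| DistAtom (i j : I)
| PredAtom (P : Pred L) (v : Fin.t (arity L P) -> I).
Arguments DistAtom {L I}.
Arguments PredAtom {L I}.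

Lemma countable_atom (L : signature) (I : Type) : countable I -> countable (atom L I).
Proof.
  intros HI; apply (@countable_inj _ (I * I + {P : Pred L & Fin.t (arity L P) -> I})
    (fun α => match α with DistAtom i j => inl (i, j) | PredAtom P v => inr (existT _ P v) end)).
  - intros [i j|P v] [i' j'|P' v'] E; try discriminate E.
    + now injection E as -> ->.
    + assert (E' : existT (fun P => Fin.t (arity L P) -> I) P v = existT _ P' v')
        by congruence.
      exact (f_equal (fun p => PredAtom (projT1 p) (projT2 p)) E').
  - apply countable_sum; [now apply countable_prod|].
    apply countable_sigT; [exists (pred_code L); exact (pred_code_inj L)|].
    intros P; now apply countable_fin_function.
Qed.

Section Structures.
Context {L : signature}.

Definition atom_value {I} (M : structure L) (s : I -> M) (α : atom L I) : R :=
  match α with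
  | DistAtom i j => dist M (s i) (s j)
  | PredAtom P v => interp M P (fun k => s (v k))
  end.

Definition atom_map {I J} (σ : I -> J) (α : atom L I) : atom L J :=
  match α with
  | DistAtom i j => DistAtom (σ i) (σ j)
  | PredAtom P v => PredAtom P (fun k => σ (v k))
  end.

Definition atom_uses {I} (α : atom L I) (i : I) : Prop :=
  match α with
  | DistAtom j k => i = j \/ i = k
  | PredAtom P v => exists k, i = v k
  end.

Lemma atom_value_map {I J} (M : structure L) (σ : I -> J) (s : J -> M) α :
  atom_value M s (atom_map σ α) = atom_value M (fun i => s (σ i)) α.
Proof. now destruct α. Qed.

Lemma atom_value_ext {I} {M : structure L} α (s s' : I -> M) :
  (forall i, atom_uses α i -> s i = s' i) -> atom_value M s α = atom_value M s' α.
Proof.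
  intros Hs; destruct α as [i j|P v]; simpl in *; [rewrite !Hs; auto|].
  f_equal; extensionality k; apply Hs; now exists k.
Qed.

Lemma atom_uses_bounded (α : atom L nat) :
  eventually (fun K => forall i, atom_uses α i -> (i < K)%nat).
Proof.
  destruct α as [i j|P v]; simpl.
  - exists (S (i + j)); intros K HK k [->| ->]; lia.
  - destruct (Fin_Finite (arity L P)) as [l Hl]; exists (S (list_max (map v l))).
    intros K HK i [k ->]; pose proof (proj1 (list_max_le (map v l) (pred K)) ltac:(lia)) as Hmax.
    rewrite Forall_forall in Hmax; specialize (Hmax (v k) (in_map v l k (Hl k))); lia.
Qed.

Definition close (M : structure L) (r : R) : relation (list M) :=
  Forall2 (fun a b => dist M a b < r).

Lemma close_mono (M : structure L) r r' x y : r <= r' -> close M r x y -> close M r' x y.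
Proof. intros Hr; apply Forall2_impl; intros; lra. Qed.

Lemma close_nth (M : structure L) r x y i d d' :
  close M r x y -> dist M d d' < r -> dist M (nth i x d) (nth i y d') < r.
Proof. apply (Forall2_nth (fun a b => dist M a b < r)). Qed.

Section Prestructure.
Context {M : structure L} {preM : prestructure M}.

Lemma dist_lt_triangle (x y z : M) r s :
  dist M x y < r -> dist M y z < s -> dist M x z < r + s.
Proof. pose proof (dist_triangle x y z); lra. Qed.

Lemma close_refl r x : 0 < r -> close M r x x.
Proof. intros Hr; induction x; constructor; [now rewrite dist_refl|easy]. Qed.

Lemma close_sym r : symmetric _ (close M r).
Proof. intros x y; apply Forall2_sym; intros a b; now rewrite dist_sym. Qed.

Lemma close_trans r s x y z : close M r x y -> close M s y z -> close M (r + s) x z.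
Proof.
  intros Hxy; revert z; induction Hxy as [|a b x y Hab Hxy IH]; intros z Hyz;
    inversion Hyz as [|? c ? z' Hbc Hyz']; subst; constructor.
  - now apply dist_lt_triangle with b.
  - now apply IH.
Qed.

Lemma close_open r x y : close M r x y -> eventually (fun n =>
  forall x' y', close M (eps n) x x' -> close M (eps n) y y' -> close M r x' y').
Proof.
  intros Hxy; assert (Hslack : eventually (fun n => close M (r - 2 * eps n) x y)).
  { apply eventually_Forall2; apply Forall2_impl with (2 := Hxy); intros a b Hab.
    apply filter_imp with (2 := eventually_eps_lt ((r - dist M a b) / 2) ltac:(lra)).
    intros n; lra. }
  apply filter_imp with (2 := Hslack); intros n Hn x' y' Hx Hy.
  replace r with (eps n + (r - 2 * eps n) + eps n) by lra.
  apply close_trans with y; [|exact Hy].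
  apply close_trans with x; [now apply close_sym|exact Hn].
Qed.

Lemma dist_perturb (x y x' y' : M) r :
  dist M x x' < r -> dist M y y' < r -> Rabs (dist M x y - dist M x' y') < 2 * r.
Proof.
  intros Hx Hy; pose proof (dist_triangle x x' y); pose proof (dist_triangle x' x y').
  pose proof (dist_triangle x' y' y); pose proof (dist_triangle x y y').
  rewrite (dist_sym x' x), (dist_sym y' y) in *; apply Rabs_def1; lra.
Qed.

Lemma atom_value_continuous {I} (α : atom L I) e : 0 < e -> eventually (fun n =>
  forall s s' : I -> M, (forall i, atom_uses α i -> dist M (s i) (s' i) < eps n) ->
    Rabs (atom_value M s α - atom_value M s' α) < e).
Proof.
  intros He; destruct α as [i j|P v]; simpl.
  - apply filter_imp with (2 := eventually_eps_lt (e / 2) ltac:(lra)).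
    intros n Hn s s' Hs; apply Rlt_trans with (2 * eps n); [|lra].
    apply dist_perturb; auto.
  - apply filter_imp with
      (2 := eventually_eps_lt _ (modulus_pos L P (e / 2) ltac:(lra))).
    intros n Hn s s' Hs; apply Rle_lt_trans with (e / 2); [|lra].
    apply interp_continuous; [lra|].
    intros k; apply Rlt_trans with (eps n); [apply Hs; now exists k|easy].
Qed.
End Prestructure.

Definition adherent {I} {M : structure L} (u : I -> M) (z : M) : Prop :=
  forall e, 0 < e -> exists i, dist M (u i) z < e.

Definition dense_family {I} {M : structure L} (u : I -> M) : Prop := forall z, adherent u z.

Record dense_embedding (A M : structure L) (f : A -> M) : Prop := {
  embedding_atom : forall α, atom_value M f α = atom_value A (fun a => a) α;
  embedding_dense : dense_family f }.

Section DenseEmbedding.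
Context {A M : structure L} {preM : prestructure M}.
Context {f : A -> M} (Hf : dense_embedding A M f).

Lemma embedding_dist a b : dist M (f a) (f b) = dist A a b.
Proof. exact (embedding_atom A M f Hf (DistAtom a b)). Qed.

Lemma embedding_atom_comp {I} (s : I -> A) α :
  atom_value M (fun i => f (s i)) α = atom_value A s α.
Proof.
  pose proof (embedding_atom A M f Hf (atom_map s α)) as Hα; now rewrite !atom_value_map in Hα.
Qed.

Lemma close_map r x y : close M r (map f x) (map f y) <-> close A r x y.
Proof.
  revert y; induction x as [|a x IH]; intros [|b y]; simpl; split; intros Hxy;
    inversion Hxy; subst; constructor; try (now apply IH).
  - now rewrite <- embedding_dist.
  - now rewrite embedding_dist.
Qed.

Lemma dense_tuple x n : exists s, close M (eps n) x (map f s).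
Proof.
  destruct (Forall2_ex (fun _ : M => True) (fun a b => dist M a (f b) < eps n) x)
    as [s Hs].
  - intros a _; destruct (embedding_dense A M f Hf a _ (eps_pos n)) as [b Hb].
    exists b; now rewrite dist_sym.
  - now apply Forall_forall.
  - exists s; induction Hs; constructor; easy.
Qed.

Lemma clos_refl_trans_pullback (R : relation (list A)) (R' : relation (list M)) x v :
  (forall u v, R' u v -> eventually (fun n => forall a b,
    close M (eps n) u (map f a) -> close M (eps n) v (map f b) -> R a b)) ->
  R' (map f x) (map f x) -> clos_refl_trans _ R' (map f x) v ->
  eventually (fun n => forall b, close M (eps n) v (map f b) -> clos_refl_trans _ R x b).
Proof.
  intros Hopen Hx Hv.
  induction Hv as [|u v _ IH Huv] using clos_refl_trans_ind_left.
  - apply filter_imp with (2 := Hopen _ _ Hx); intros n Hn b Hb.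
    apply rt_step, Hn; [apply close_refl, eps_pos|easy].
  - apply filter_imp with (2 := filter_and _ _ IH (Hopen _ _ Huv)); intros n [Hu Hstep] b Hb.
    destruct (dense_tuple u n) as [a Ha].
    apply rt_trans with a; [now apply Hu|now apply rt_step, Hstep].
Qed.
End DenseEmbedding.

Lemma dense_embedding_isometry (A M N : structure L) f g : dense_embedding A M f ->
  (forall y : N, exists x : M, g x = y) ->
  (forall x y, dist N (g x) (g y) = dist M x y) ->
  (forall P (a : Fin.t (arity L P) -> M), interp N P (fun k => g (a k)) = interp M P a) ->
  dense_embedding A N (fun s => g (f s)).
Proof.
  intros Hf Hsurj Hdist Hinterp; split.
  - intros α; rewrite <- (embedding_atom A M f Hf).
    destruct α as [i j|P v]; [apply Hdist|apply (Hinterp P (fun k => f (v k)))].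
  - intros y e He; destruct (Hsurj y) as [x <-].
    destruct (embedding_dense A M f Hf x e He) as [s Hs]; exists s; now rewrite Hdist.
Qed.
End Structures.

(** * Pieces *)

(* The parameters [c], [r], [D], [e] and [d] are exponents: [r] stands for the real [eps r]. *)
Inductive label (L : signature) : Type :=
| Free
| Value (α : atom L nat) (z : Z) (c : nat)
| Ball (j r : nat)
| Net (j D e : nat)
| Packing (n d k : nat).
Arguments Free {L}.
Arguments Value {L}.
Arguments Ball {L}.
Arguments Net {L}.
Arguments Packing {L}.

Lemma countable_label (L : signature) : countable (label L).
Proof.
  apply (@countable_inj _ (option (atom L nat * Z * nat) + (nat * list nat)) (fun l => match l with
    | Free => inl None
    | Value α z c => inl (Some (α, z, c))
    | Ball j r => inr (0, [j; r])
    | Net j D e => inr (1, [j; D; e])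
    | Packing n d k => inr (2, [n; d; k])
    end)%nat).
  - intros [] [] E; try discriminate E; try injection E; intros; subst; easy.
  - auto 10 using countable_sum, countable_option, countable_prod, countable_list,
      countable_nat, countable_Z, countable_atom.
Qed.

Definition near (v : R) (z : Z) (c : nat) : Prop := Rabs (v - IZR z * eps c) < eps c.

Lemma near_exists v c : exists z, near v z c.
Proof.
  pose proof (eps_pos c) as Hc; exists (Int_part (v / eps c)); unfold near.
  destruct (base_Int_part (v / eps c)) as [Hle Hgt].
  replace (v - _) with ((v / eps c - IZR (Int_part (v / eps c))) * eps c) by (field; lra).
  rewrite Rabs_pos_eq; nra.
Qed.

Lemma near_dist v w z c : near v z c -> near w z c -> Rabs (v - w) < 2 * eps c.
Proof.
  intros Hv Hw; apply Rabs_def2 in Hv; apply Rabs_def2 in Hw; apply Rabs_def1; lra.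
Qed.

Lemma near_open v z c :
  near v z c -> exists e, 0 < e /\ forall w, Rabs (v - w) < e -> near w z c.
Proof.
  intros Hv; exists (eps c - Rabs (v - IZR z * eps c)); unfold near in *.
  split; [lra|]; intros w Hw; rewrite Rabs_minus_sym in Hw.
  replace (w - _) with ((w - v) + (v - IZR z * eps c)) by ring.
  eapply Rle_lt_trans; [apply Rabs_triang|lra].
Qed.

Section Pieces.
Context {L : signature}.

Definition netted (M : structure L) (x : M) (r : R) (u : list M) (e : R) : Prop :=
  forall z, dist M x z < r -> exists y, In y u /\ dist M y z < e.

Definition totally_bounded_ball (M : structure L) (x : M) (r : R) : Prop :=
  forall e, exists u, netted M x r u (eps e).

Definition close_upto (M : structure L) (n : nat) (r : R) (u v : list M) : Prop :=
  close M r (firstn n u) (firstn n v).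

Definition packed (M : structure L) (p : list M -> Prop) (n : nat) (r s : R) (k : nat)
    (x : list M) : Prop :=
  forall us, length us = k -> Forall (fun u => p u /\ close_upto M n r u x) us ->
    ~ ForallOrdPairs (fun u v => ~ close_upto M n s u v) us.

(* Tuples list their oldest coordinate [d] first; it also serves as the value of missing ones.
   The slack [eps h] makes each condition open and determined by any dense subset. *)
Definition label_holds (M : structure L) (l : label L) (p : list M -> Prop) (d : M) (x : list M)
    : Prop :=
  match l with
  | Free => True
  | Value α z c => near (atom_value M (fun i => nth i x d) α) z c
  | Ball j r => exists h, totally_bounded_ball M (nth j x d) (eps r + eps h)
  | Net j D e => exists h, netted M (nth j x d) (eps D + eps h) x (eps e - eps h)
  | Packing n d k => exists h, packed M p n (2 * eps d + eps h) (eps d - eps h) k x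
  end.

Definition admissible (M : structure L) (l : label L) (n : nat) (E : relation (list M))
    (x : list M) : Prop :=
  match x with
  | [] => False
  | d :: _ => length x = S n /\ E (firstn n x) (firstn n x) /\
      label_holds M l (E (firstn n x)) d x
  end.

Definition piece_step (M : structure L) (l : label L) (n : nat) (E : relation (list M))
    : relation (list M) := fun x y =>
  admissible M l n E x /\ admissible M l n E y /\ E (firstn n x) (firstn n y) /\
  close M (eps n) x y.

(* A partial equivalence relation, whose classes are the pieces.  The newest label comes first. *)
Fixpoint piece (M : structure L) (lam : list (label L)) : relation (list M) :=
  match lam with
  | [] => fun x y => x = [] /\ y = []
  | l :: lam => fun x y => admissible M l (length lam) (piece M lam) x /\
      clos_refl_trans _ (piece_step M l (length lam) (piece M lam)) x y
  end.

(* The tree order on pieces, each represented by one of its elements. *)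
Definition below (M : structure L) (lam : list (label L)) (x : list M)
    (lam' : list (label L)) (x' : list M) : Prop :=
  suffix lam lam' /\ piece M lam' x' x' /\ piece M lam x (firstn (length lam) x').

Lemma packed_transport {M N : structure L} (T : list M -> list N -> Prop)
    p p' n r s r' s' k x x' :
  (forall u', p' u' -> close_upto N n r' u' x' ->
    exists u, (p u /\ close_upto M n r u x) /\ T u u') ->
  (forall u v u' v', T u u' -> T v v' ->
    close_upto M n s u v -> close_upto N n s' u' v') ->
  packed M p n r s k x -> packed N p' n r' s' k x'.
Proof.
  intros Hp HT Hk us' Hlen Hus' Hsep.
  destruct (Forall2_ex (fun u' => p' u' /\ close_upto N n r' u' x')
    (fun u' u => (p u /\ close_upto M n r u x) /\ T u u') us') as [us Hus]; [|exact Hus'|].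
  { intros u' [Hu' Hx']; now apply Hp. }
  apply (Hk us).
  - now rewrite <- (Forall2_length Hus).
  - clear - Hus; induction Hus; constructor; easy.
  - revert Hus Hsep; apply ForallOrdPairs_Forall2.
    intros u' v' u v [_ Hu] [_ Hv] Hn Huv; now apply Hn, (HT u v).
Qed.

Lemma packed_mono {M : structure L} p p' n r r' s s' k x x' :
  (forall u, p' u -> p u) ->
  (forall u, close_upto M n r' u x' -> close_upto M n r u x) -> s <= s' ->
  packed M p n r s k x -> packed M p' n r' s' k x'.
Proof.
  intros Hp Hx Hs; apply packed_transport with (T := eq).
  - intros u Hu Hux; exists u; auto.
  - intros u v u' v' <- <-; now apply close_mono.
Qed.

Section Openness.
Context {M : structure L} {preM : prestructure M}.

Lemma netted_move (x x' : M) r r' u e :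
  netted M x r u e -> dist M x x' + r' <= r -> netted M x' r' u e.
Proof. intros Hu Hr z Hz; apply Hu; pose proof (dist_triangle x x' z); lra. Qed.

Lemma netted_close (x : M) r u u' e d :
  netted M x r u e -> close M d u u' -> netted M x r u' (e + d).
Proof.
  intros Hu Hc z Hz; destruct (Hu z Hz) as [y [Hy Hyz]].
  destruct (Forall2_In_l _ _ _ _ Hc Hy) as [y' [Hy' Hyy']]; exists y'; split; [easy|].
  rewrite dist_sym in Hyy'; pose proof (dist_triangle y' y z); lra.
Qed.

Lemma totally_bounded_ball_move (x x' : M) r r' :
  totally_bounded_ball M x r -> dist M x x' + r' <= r -> totally_bounded_ball M x' r'.
Proof.
  intros Hx Hr e; destruct (Hx e) as [u Hu]; exists u; now apply netted_move with x r.
Qed.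

Lemma totally_bounded_ball_le (x : M) r r' :
  totally_bounded_ball M x r -> r' <= r -> totally_bounded_ball M x r'.
Proof.
  intros Hx Hr; apply totally_bounded_ball_move with x r; [easy|rewrite dist_refl; lra].
Qed.

Lemma close_upto_sym n r : symmetric _ (close_upto M n r).
Proof. intros x y; apply close_sym. Qed.

Lemma close_upto_trans n r s x y z :
  close_upto M n r x y -> close_upto M n s y z -> close_upto M n (r + s) x z.
Proof. apply close_trans. Qed.

Lemma label_holds_open l p d x : label_holds M l p d x -> eventually (fun n => forall p' d' x',
  (forall u, p' u -> p u) -> dist M d d' < eps n -> close M (eps n) x x' ->
  label_holds M l p' d' x').
Proof.
  destruct l as [|α z c|j r|j D e|n d0 k]; simpl.
  - now exists O.
  - intros Hv; destruct (near_open _ _ _ Hv) as [e [He Hnear]].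
    apply filter_imp with (2 := atom_value_continuous (M := M) α e He).
    intros n Hn p' d' x' _ Hd Hx; apply Hnear, Hn; intros i _; now apply close_nth.
  - intros [h Hh]; exists (S h); intros n Hn p' d' x' _ Hd Hx; exists (S h).
    apply totally_bounded_ball_move with (1 := Hh).
    pose proof (close_nth _ _ _ _ j _ _ Hx Hd); pose proof (eps_le _ _ Hn).
    rewrite eps_S in *; lra.
  - intros [h Hh]; exists (S h); intros n Hn p' d' x' _ Hd Hx; exists (S h).
    pose proof (eps_le _ _ Hn) as Hle; rewrite eps_S in *.
    replace (eps e - eps h / 2) with (eps e - eps h + eps h / 2) by lra.
    apply netted_close with x; [|now apply close_mono with (eps n)].
    apply netted_move with (1 := Hh); pose proof (close_nth _ _ _ _ j _ _ Hx Hd); lra.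
  - intros [h Hh]; exists (S h); intros m Hm p' d' x' Hp _ Hx; exists (S h).
    pose proof (eps_le _ _ Hm) as Hle; rewrite eps_S in *; pose proof (eps_pos h).
    revert Hh; apply packed_mono; [exact Hp| |lra]; intros u Hux.
    apply close_mono with (2 * eps d0 + eps h / 2 + eps m); [lra|].
    apply close_upto_trans with x'; [easy|now apply close_upto_sym, Forall2_firstn].
Qed.

Record open_per (E : relation (list M)) : Prop := {
  open_per_sym : symmetric _ E;
  open_per_trans : transitive _ E;
  open_per_open : forall x y, E x y ->
    eventually (fun n => forall y', close M (eps n) y y' -> E x y') }.

Lemma open_per_firstn E n x y : open_per E -> E (firstn n x) (firstn n y) ->
  eventually (fun m => forall x' y', close M (eps m) x x' -> close M (eps m) y y' ->
    E (firstn n x') (firstn n y')).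
Proof.
  intros HE Hxy; pose proof (open_per_sym _ HE _ _ Hxy) as Hyx.
  apply filter_imp with
    (2 := filter_and _ _ (open_per_open _ HE _ _ Hxy) (open_per_open _ HE _ _ Hyx)).
  intros m [Hy Hx] x' y' Hx' Hy'; apply (open_per_trans _ HE) with (firstn n y).
  - apply (open_per_sym _ HE), Hx; now apply Forall2_firstn.
  - apply (open_per_trans _ HE) with (firstn n x); [easy|].
    apply Hy; now apply Forall2_firstn.
Qed.

Lemma admissible_open l n E x : open_per E -> admissible M l n E x ->
  eventually (fun m => forall x', close M (eps m) x x' -> admissible M l n E x').
Proof.
  intros HE; destruct x as [|d x]; [easy|]; intros (Hlen & Hparent & Hcond).
  apply filter_imp with (2 := filter_and _ _ (label_holds_open _ _ _ _ Hcond)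
    (open_per_firstn E n _ _ HE Hparent)).
  intros m [Hc Hp] x' Hx'; assert (Hd : close M (eps m) (d :: x) (d :: x))
    by apply close_refl, eps_pos.
  pose proof (Hp _ _ Hd Hx') as Hxx'; pose proof (Hp _ _ Hx' Hx') as Hx'x'.
  inversion Hx' as [|? d' ? y Hdd' Hxy]; subst.
  split; [now rewrite <- (Forall2_length Hx')|]; split; [easy|].
  apply Hc; [|easy|easy]; intros u Hu; now apply (open_per_trans _ HE) with (1 := Hxx').
Qed.

Lemma admissible_label_holds l n E x :
  admissible M l n E x -> exists d, label_holds M l (E (firstn n x)) d x.
Proof. destruct x as [|d x]; [easy|]; intros (_ & _ & Hc); now exists d. Qed.

Lemma piece_step_sym l n E : symmetric _ E -> symmetric _ (piece_step M l n E).
Proof.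
  intros HE x y (Hx & Hy & Hparent & Hc); repeat split; auto; now apply close_sym.
Qed.

Lemma piece_step_refl l n E x : admissible M l n E x -> piece_step M l n E x x.
Proof.
  intros Hx; repeat split; [easy|easy| |apply close_refl, eps_pos].
  destruct x; [easy|apply Hx].
Qed.

Lemma piece_step_open l n E x y : open_per E -> piece_step M l n E x y ->
  eventually (fun m => forall x' y', close M (eps m) x x' -> close M (eps m) y y' ->
    piece_step M l n E x' y').
Proof.
  intros HE (Hx & Hy & Hparent & Hc).
  apply filter_imp with (2 := filter_and _ _ (filter_and _ _
    (admissible_open _ _ _ _ HE Hx) (admissible_open _ _ _ _ HE Hy))
    (filter_and _ _ (open_per_firstn _ _ _ _ HE Hparent) (close_open _ _ _ Hc))).
  intros m [[Hxm Hym] [Hpm Hcm]] x' y' Hx' Hy'; repeat split; auto.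
Qed.

Lemma piece_step_chain_admissible l n E x y : admissible M l n E x ->
  clos_refl_trans _ (piece_step M l n E) x y -> admissible M l n E y.
Proof. intros Hx; induction 1 as [x y Hxy| |]; [apply Hxy|easy|auto]. Qed.

Lemma piece_open_per lam : open_per (piece M lam).
Proof.
  induction lam as [|l lam IH]; split; simpl.
  - intros x y []; easy.
  - intros x y z [] []; easy.
  - intros x y [-> ->]; exists O; intros n _ y' Hy'; inversion Hy'; easy.
  - intros x y [Hx Hxy]; split; [now apply piece_step_chain_admissible with x|].
    now apply clos_refl_trans_sym; [apply piece_step_sym, IH|].
  - intros x y z [Hx Hxy] [_ Hyz]; split; [easy|now apply rt_trans with y].
  - intros x y [Hx Hxy]; pose proof (piece_step_chain_admissible _ _ _ _ _ Hx Hxy) as Hy.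
    apply filter_imp with (2 := piece_step_open _ _ _ _ _ IH (piece_step_refl _ _ _ _ Hy)).
    intros m Hm y' Hy'; split; [easy|]; apply rt_trans with y; [easy|].
    apply rt_step, Hm; [apply close_refl, eps_pos|easy].
Qed.

Lemma piece_sym lam : symmetric _ (piece M lam).
Proof. apply open_per_sym, piece_open_per. Qed.

Lemma piece_trans lam : transitive _ (piece M lam).
Proof. apply open_per_trans, piece_open_per. Qed.

Lemma piece_open lam x y : piece M lam x y ->
  eventually (fun n => forall y', close M (eps n) y y' -> piece M lam x y').
Proof. apply open_per_open, piece_open_per. Qed.

Lemma piece_refl_l lam x y : piece M lam x y -> piece M lam x x.
Proof. intros Hxy; apply piece_trans with y; [easy|now apply piece_sym]. Qed.

Lemma piece_refl_r lam x y : piece M lam x y -> piece M lam y y.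
Proof. intros Hxy; apply piece_trans with x; [now apply piece_sym|easy]. Qed.

Lemma piece_intro l lam x : admissible M l (length lam) (piece M lam) x ->
  piece M (l :: lam) x x.
Proof. intros Hx; split; [easy|apply rt_refl]. Qed.

Lemma piece_admissible_l l lam x y :
  piece M (l :: lam) x y -> admissible M l (length lam) (piece M lam) x.
Proof. now intros []. Qed.

Lemma piece_length_l lam x y : piece M lam x y -> length x = length lam.
Proof.
  destruct lam as [|l lam]; [now intros [-> _]|].
  intros [Hx _]; destruct x; [easy|apply Hx].
Qed.

Lemma piece_length_r lam x y : piece M lam x y -> length y = length lam.
Proof. intros Hxy; apply piece_sym in Hxy; now apply piece_length_l in Hxy. Qed.

Lemma piece_parent l lam x y : piece M (l :: lam) x y ->
  piece M lam (firstn (length lam) x) (firstn (length lam) y).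
Proof.
  intros [Hx Hxy]; induction Hxy as [|y z _ IH Hyz] using clos_refl_trans_ind_left.
  - destruct x; [easy|apply Hx].
  - apply piece_trans with (1 := IH); apply Hyz.
Qed.

Lemma piece_firstn lam lam' x y : suffix lam lam' -> piece M lam' x y ->
  piece M lam (firstn (length lam) x) (firstn (length lam) y).
Proof.
  intros [mu ->]; revert x y; induction mu as [|l mu IH]; intros x y Hxy; simpl in Hxy.
  - now rewrite !firstn_all2; [|erewrite piece_length_r by eauto|erewrite piece_length_l by eauto].
  - apply piece_parent, IH in Hxy.
    rewrite !firstn_firstn, length_app, Nat.min_l in Hxy by lia; exact Hxy.
Qed.

Lemma below_refl lam x y : piece M lam x y -> below M lam x lam y.
Proof.
  intros Hxy; split; [apply suffix_refl|]; split; [now apply piece_refl_r with x|].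
  now rewrite firstn_all2 by (erewrite piece_length_r by eauto; lia).
Qed.

Lemma below_trans lam x lam' x' lam'' x'' :
  below M lam x lam' x' -> below M lam' x' lam'' x'' -> below M lam x lam'' x''.
Proof.
  intros (Hs & Hx' & Hxx') (Hs' & Hx'' & Hx'x''); split; [now apply suffix_trans with lam'|].
  split; [easy|]; apply piece_trans with (1 := Hxx').
  apply (piece_firstn _ _ _ _ Hs) in Hx'x''.
  rewrite firstn_firstn, Nat.min_l in Hx'x'' by (now apply suffix_length); exact Hx'x''.
Qed.

Lemma below_child l lam x : piece M (l :: lam) x x ->
  below M lam (firstn (length lam) x) (l :: lam) x.
Proof. intros Hx; split; [apply suffix_cons|]; split; [easy|now apply piece_parent in Hx]. Qed.

Lemma below_piece_l lam x y lam' x' :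
  piece M lam x y -> below M lam y lam' x' -> below M lam x lam' x'.
Proof. intros Hxy; apply below_trans; now apply below_refl. Qed.

Lemma below_piece_r lam x lam' x' y' :
  below M lam x lam' x' -> piece M lam' x' y' -> below M lam x lam' y'.
Proof. intros Hx Hxy; apply below_trans with (1 := Hx); now apply below_refl. Qed.
End Openness.
End Pieces.

Section Transfer.
Context {L : signature} {A M : structure L} {preM : prestructure M}.
Context {f : A -> M} (Hf : dense_embedding A M f).

Lemma netted_pullback x r u e : netted M (f x) r (map f u) e -> netted A x r u e.
Proof.
  intros Hu z Hz; destruct (Hu (f z)) as [y [Hy Hyz]].
  - now rewrite (embedding_dist Hf).
  - apply in_map_iff in Hy; destruct Hy as [y' [<- Hy']]; exists y'; split; [easy|].
    now rewrite <- (embedding_dist Hf).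
Qed.

Lemma netted_pushforward x r u e d : 0 < d ->
  netted A x (r + d) u e -> netted M (f x) r (map f u) (e + d).
Proof.
  intros Hd Hu z Hz; destruct (embedding_dense A M f Hf z d Hd) as [s Hs].
  assert (Hs' : dist M z (f s) < d) by now rewrite dist_sym.
  destruct (Hu s) as [y [Hy Hys]].
  - rewrite <- (embedding_dist Hf); now apply dist_lt_triangle with z.
  - exists (f y); split; [now apply in_map|].
    apply dist_lt_triangle with (f s); [now rewrite (embedding_dist Hf)|easy].
Qed.

Lemma totally_bounded_ball_pullback x r :
  totally_bounded_ball M (f x) r -> totally_bounded_ball A x r.
Proof.
  intros Hx e; destruct (Hx (S e)) as [u Hu]; destruct (dense_tuple Hf u (S e)) as [s Hs].
  exists s; apply netted_pullback.
  replace (eps e) with (eps (S e) + eps (S e)) by (rewrite eps_S; lra).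
  now apply netted_close with u.
Qed.

Lemma totally_bounded_ball_pushforward x r d : 0 < d ->
  totally_bounded_ball A x (r + d) -> totally_bounded_ball M (f x) r.
Proof.
  intros Hd Hx e; destruct (eventually_and_ex _ _ (eventually_ge (S e))
    (eventually_eps_lt d Hd)) as [n [Hn Hnd]].
  destruct (Hx n) as [u Hu]; exists (map f u); intros z Hz.
  destruct (netted_pushforward x r u (eps n) (eps n) (eps_pos n)) with z as (y & Hy & Hyz).
  - intros z' Hz'; apply Hu; lra.
  - exact Hz.
  - exists y; split; [easy|]; pose proof (eps_le _ _ Hn); rewrite eps_S in *; lra.
Qed.

Lemma close_upto_map n r u v :
  close_upto M n r (map f u) (map f v) <-> close_upto A n r u v.
Proof. unfold close_upto; rewrite !firstn_map; apply (close_map Hf). Qed.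

Section Class.
Context (pA : list A -> Prop) (pM : list M -> Prop).
Context (HpA : forall u, pA u <-> pM (map f u)).
Context (HpM : forall u, pM u ->
  eventually (fun n => forall u', close M (eps n) u u' -> pM u')).

Lemma packed_pullback n r s k x : packed M pM n r s k (map f x) -> packed A pA n r s k x.
Proof.
  apply packed_transport with (T := fun u u' => u = map f u').
  - intros u Hu Hux; exists (map f u); split; [|easy].
    split; [now apply HpA|now apply close_upto_map].
  - intros u v u' v' -> ->; apply close_upto_map.
Qed.

Lemma packed_pushforward n r s k x d : 0 < d ->
  packed A pA n (r + d) s k x -> packed M pM n r (s + 2 * d) k (map f x).
Proof.
  intros Hd; apply packed_transport with
    (T := fun u u' => close_upto M n d u' (map f u)).
  - intros u Hu Hux; destruct (eventually_and_ex _ _ (HpM u Hu)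
      (eventually_eps_lt d Hd)) as [m [Hm Hmd]].
    destruct (dense_tuple Hf u m) as [v Hv]; exists v.
    assert (Huv : close_upto M n d u (map f v))
      by (apply Forall2_firstn, close_mono with (eps m); [lra|easy]).
    split; [split|easy]; [now apply HpA, Hm|]; apply close_upto_map.
    rewrite Rplus_comm; apply close_upto_trans with u; [now apply close_upto_sym|easy].
  - intros u v u' v' Hu Hv Huv; apply close_upto_map in Huv.
    replace (s + 2 * d) with (d + s + d) by ring.
    apply close_upto_trans with (map f v); [|now apply close_upto_sym].
    now apply close_upto_trans with (map f u).
Qed.

Lemma label_holds_transfer l d x : label_holds A l pA d x <-> label_holds M l pM (f d) (map f x).
Proof.
  destruct l as [|α z c|j r|j D e|n d0 k]; simpl; rewrite ?map_nth.
  - easy.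
  - replace (fun i => nth i (map f x) (f d)) with (fun i => f (nth i x d))
      by (extensionality i; now rewrite map_nth).
    now rewrite (embedding_atom_comp Hf).
  - split; intros [h Hh].
    + exists (S h); apply totally_bounded_ball_pushforward with (eps (S h)); [apply eps_pos|].
      now replace (_ + _) with (eps r + eps h) by (rewrite eps_S; lra).
    + exists h; now apply totally_bounded_ball_pullback.
  - split; intros [h Hh].
    + exists (S h); replace (eps e - eps (S h)) with (eps e - eps h + eps (S h))
        by (rewrite eps_S; lra).
      apply netted_pushforward; [apply eps_pos|].
      now replace (_ + _) with (eps D + eps h) by (rewrite eps_S; lra).
    + exists h; now apply netted_pullback.
  - split; intros [h Hh].
    + exists (S (S h)); replace (eps d0 - eps (S (S h))) with
        (eps d0 - eps h + eps (S (S h)) + 2 * eps (S (S h))) by (rewrite !eps_S; lra).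
      apply packed_pushforward; [apply eps_pos|]; pose proof (eps_pos h).
      revert Hh; apply packed_mono; [easy| |rewrite !eps_S; lra].
      intros u; apply close_mono; rewrite !eps_S; lra.
    + exists h; now apply packed_pullback.
Qed.
End Class.

Lemma piece_transfer lam x y : piece A lam x y <-> piece M lam (map f x) (map f y).
Proof.
  revert x y; induction lam as [|l lam IH]; intros x y.
  - simpl; split; intros [Hx Hy]; [now subst|]; split; eapply map_eq_nil; eassumption.
  - assert (Hadm : forall u, admissible A l (length lam) (piece A lam) u <->
      admissible M l (length lam) (piece M lam) (map f u)).
    { intros [|d u]; [easy|]; cbn [admissible map].
      rewrite <- map_cons, firstn_map, length_map, <- IH.
      rewrite (label_holds_transfer _ (piece M lam (map f (firstn (length lam) (d :: u)))));
        [easy|intros v; apply IH|apply piece_open]. }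
    assert (Hstep : forall u v, piece_step A l (length lam) (piece A lam) u v <->
      piece_step M l (length lam) (piece M lam) (map f u) (map f v)).
    { intros u v; unfold piece_step; now rewrite !Hadm, !firstn_map, IH, (close_map Hf). }
    simpl; rewrite Hadm; split; intros [Hx Hxy]; (split; [easy|]).
    + clear Hx; induction Hxy; [now apply rt_step, Hstep|apply rt_refl|].
      eapply rt_trans; eassumption.
    + enough (Hnear : eventually (fun n => forall b, close M (eps n) (map f y) (map f b) ->
        clos_refl_trans _ (piece_step A l (length lam) (piece A lam)) x b)).
      { destruct Hnear as [N HN]; apply (HN N (le_n N)), close_refl, eps_pos. }
      revert Hxy; apply (clos_refl_trans_pullback Hf); [|now apply piece_step_refl].
      intros u v Huv.
      apply filter_imp with (2 := piece_step_open _ _ _ _ _ (piece_open_per lam) Huv).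
      intros n Hn a b Ha Hb; now apply Hstep, Hn.
Qed.

Lemma below_transfer lam x lam' x' :
  below A lam x lam' x' <-> below M lam (map f x) lam' (map f x').
Proof. unfold below; now rewrite firstn_map, <- !piece_transfer. Qed.

Lemma dense_in_piece lam x : piece M lam x x -> exists s, piece M lam x (map f s).
Proof.
  intros Hx; destruct (piece_open lam x x Hx) as [n Hn].
  destruct (dense_tuple Hf x n) as [s Hs]; exists s; now apply (Hn n).
Qed.
End Transfer.

(** * The Borel map to countable structures *)

Section SigmaGen.
Context {X : Type} {G : (X -> Prop) -> Prop} (nonempty : exists A, sigma_gen G A).

Lemma sigma_gen_const (P : Prop) : sigma_gen G (fun _ => P).
Proof.
  destruct nonempty as [A HA].
  assert (HT : sigma_gen G (fun _ => True)).
  { apply sg_ext with (fun x => exists n : nat, (match n with O => A | _ => fun x => ~ A x end) x).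
    - apply sg_union; intros [|n]; [easy|now apply sg_compl].
    - intros x; split; [easy|intros _].
      destruct (classic (A x)); [now exists O|now exists 1%nat]. }
  destruct (classic P) as [HP|HP]; [now apply sg_ext with (1 := HT)|].
  now apply sg_ext with (1 := sg_compl _ _ HT).
Qed.

Lemma sigma_gen_ex {I} (P : I -> X -> Prop) : countable I ->
  (forall i, sigma_gen G (P i)) -> sigma_gen G (fun x => exists i, P i x).
Proof.
  intros [code Hcode] HP.
  apply sg_ext with (fun x => exists n, (fun n x => exists i, code i = n /\ P i x) n x).
  - apply sg_union; intros n; destruct (classic (exists i, code i = n)) as [[i <-]|Hn].
    + apply sg_ext with (1 := HP i); intros x; split; [intros Hi; now exists i|].
      intros [j [E Hj]]; apply Hcode in E; now subst.
    + apply sg_ext with (1 := sigma_gen_const False); intros x; split; [easy|].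
      intros [i [E _]]; apply Hn; now exists i.
  - intros x; split; [intros (n & i & _ & Hi); now exists i|intros [i Hi]].
    now exists (code i), i.
Qed.

Lemma sigma_gen_all {I} (P : I -> X -> Prop) : countable I ->
  (forall i, sigma_gen G (P i)) -> sigma_gen G (fun x => forall i, P i x).
Proof.
  intros HI HP; apply sg_ext with (fun x => ~ exists i, ~ P i x).
  - apply sg_compl, sigma_gen_ex; [easy|intros i; now apply sg_compl].
  - intros x; split; [intros Hn i; apply NNPP; intros Hi; apply Hn; now exists i|].
    intros Hall [i Hi]; now apply Hi.
Qed.

Lemma sigma_gen_and A B :
  sigma_gen G A -> sigma_gen G B -> sigma_gen G (fun x => A x /\ B x).
Proof.
  intros HA HB.
  apply sg_ext with (fun x => forall n : nat, (match n with O => A | _ => B end) x).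
  - apply sigma_gen_all; [apply countable_nat|now intros [|n]].
  - intros x; split; [intros Hall; split; [apply (Hall O)|apply (Hall 1%nat)]|].
    intros [Ha Hb] [|n]; easy.
Qed.

Lemma sigma_gen_imp A B :
  sigma_gen G A -> sigma_gen G B -> sigma_gen G (fun x => A x -> B x).
Proof.
  intros HA HB; apply sg_ext with (fun x => ~ (A x /\ ~ B x)).
  - apply sg_compl, sigma_gen_and; [easy|now apply sg_compl].
  - intros x; split; [intros Hn Ha; apply NNPP|]; tauto.
Qed.

Lemma sigma_gen_Forall {I} (P : I -> X -> Prop) l :
  (forall i, sigma_gen G (P i)) -> sigma_gen G (fun x => Forall (fun i => P i x) l).
Proof.
  intros HP; induction l as [|i l IH].
  - now apply sg_ext with (1 := sigma_gen_const True).
  - apply sg_ext with (1 := sigma_gen_and _ _ (HP i) IH).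
    intros x; symmetry; apply Forall_cons_iff.
Qed.

Lemma sigma_gen_ForallOrdPairs {I} (P : I -> I -> X -> Prop) l :
  (forall i j, sigma_gen G (P i j)) ->
  sigma_gen G (fun x => ForallOrdPairs (fun i j => P i j x) l).
Proof.
  intros HP; induction l as [|i l IH].
  - apply sg_ext with (1 := sigma_gen_const True); intros x; split; [constructor|easy].
  - apply sg_ext with (1 := sigma_gen_and _ _ (sigma_gen_Forall (P i) l (HP i)) IH).
    intros x; split; [intros []; now constructor|intros Hl; now inversion Hl].
Qed.

Lemma sigma_gen_Forall2 {I J} (P : I -> J -> X -> Prop) l l' :
  (forall i j, sigma_gen G (P i j)) ->
  sigma_gen G (fun x => Forall2 (fun i j => P i j x) l l').
Proof.
  intros HP; revert l'; induction l as [|i l IH]; intros [|j l'].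
  1: apply sg_ext with (1 := sigma_gen_const True); now split.
  1,2: apply sg_ext with (1 := sigma_gen_const False); split; [easy|intros Hl; inversion Hl].
  apply sg_ext with (1 := sigma_gen_and _ _ (HP i j) (IH l')).
  intros x; symmetry; apply Forall2_cons_iff.
Qed.

Lemma sigma_gen_clos_refl_trans {I} (P : X -> relation I) i j : countable I ->
  (forall i j, sigma_gen G (fun x => P x i j)) ->
  sigma_gen G (fun x => clos_refl_trans I (P x) i j).
Proof.
  intros HI HP.
  set (chain := fun n x => Nat.iter n (fun Q j => exists k, Q k /\ P x k j) (eq i)).
  apply sg_ext with (fun x => exists n, chain n x j).
  - apply sigma_gen_ex; [apply countable_nat|]; intros n; revert j.
    induction n as [|n IH]; intros j; [apply (sigma_gen_const (i = j))|].
    apply sigma_gen_ex; [easy|]; intros k; apply sigma_gen_and; [apply IH|apply HP].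
  - intros x; split.
    + intros [n Hn]; revert j Hn; induction n as [|n IH]; intros j Hn.
      * now rewrite <- Hn; apply rt_refl.
      * destruct Hn as [k [Hk Hkj]]; apply rt_trans with k; [auto|now apply rt_step].
    + intros Hij; induction Hij as [|k j _ [n Hn] Hkj] using clos_refl_trans_ind_left.
      * now exists O.
      * exists (S n), k; now split.
Qed.
End SigmaGen.

Section Borel.
Context {L : signature}.

Definition code_structure (c : Code L) : structure L :=
  {| carrier := nat; dist := fst c; interp := snd c |}.

Lemma code_borel_atom {I} (s : I -> nat) α r :
  code_borel (fun c => atom_value (code_structure c) s α < r).
Proof.
  apply sg_gen; destruct α as [i j|P v]; [left|right].
  - now exists (s i), (s j), r.
  - now exists P, (fun k => s (v k)), r.
Qed.

Lemma code_borel_nonempty : exists A : Code L -> Prop, code_borel A.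
Proof. eexists; apply (code_borel_atom (fun i => i) (DistAtom O O) 0). Qed.

Lemma code_borel_const (P : Prop) : code_borel (fun _ : Code L => P).
Proof. apply (sigma_gen_const code_borel_nonempty). Qed.

Lemma code_borel_dist (i j : nat) r : code_borel (fun c : Code L => fst c i j < r).
Proof. exact (code_borel_atom (fun i => i) (DistAtom i j) r). Qed.

Lemma code_borel_near {I} (s : I -> nat) α z e :
  code_borel (fun c => near (atom_value (code_structure c) s α) z e).
Proof.
  set (v := fun c : Code L => atom_value (code_structure c) s α).
  apply sg_ext with (fun c => v c < IZR z * eps e + eps e /\
    exists n, ~ (v c < IZR z * eps e - eps e + eps n)).
  - apply (sigma_gen_and code_borel_nonempty); [apply code_borel_atom|].
    apply (sigma_gen_ex code_borel_nonempty); [apply countable_nat|].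
    intros n; apply sg_compl, code_borel_atom.
  - intros c; fold (v c); unfold near; split.
    + intros [Hlt [n Hn]]; pose proof (eps_pos n); apply Rabs_def1; lra.
    + intros Hnear; apply Rabs_def2 in Hnear; split; [lra|].
      destruct (exists_eps_lt (v c - (IZR z * eps e - eps e))) as [n Hn]; [lra|].
      exists n; lra.
Qed.

Lemma code_borel_close r (x y : list nat) :
  code_borel (fun c => close (code_structure c) r x y).
Proof.
  apply (sigma_gen_Forall2 code_borel_nonempty (fun i j c => fst c i j < r)).
  intros i j; apply code_borel_dist.
Qed.

Lemma code_borel_close_upto n r (x y : list nat) :
  code_borel (fun c => close_upto (code_structure c) n r x y).
Proof. exact (code_borel_close r (firstn n x) (firstn n y)). Qed.

Lemma code_borel_netted (i : nat) r (u : list nat) e :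
  code_borel (fun c => netted (code_structure c) i r u e).
Proof.
  unfold netted; cbn [code_structure carrier dist].
  apply (sigma_gen_all code_borel_nonempty); [apply countable_nat|]; intros z.
  apply (sigma_gen_imp code_borel_nonempty); [apply code_borel_dist|].
  apply (sigma_gen_ex code_borel_nonempty); [apply countable_nat|]; intros y.
  apply (sigma_gen_and code_borel_nonempty); [apply code_borel_const|apply code_borel_dist].
Qed.

Lemma code_borel_packed (p : Code L -> list nat -> Prop) n r s k (x : list nat) :
  (forall u, code_borel (fun c => p c u)) ->
  code_borel (fun c => packed (code_structure c) (p c) n r s k x).
Proof.
  intros Hp; unfold packed; cbn [code_structure carrier].
  apply (sigma_gen_all code_borel_nonempty);
    [apply countable_list, countable_list, countable_nat|].
  intros us; apply (sigma_gen_imp code_borel_nonempty); [apply code_borel_const|].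
  apply (sigma_gen_imp code_borel_nonempty).
  - apply (sigma_gen_Forall code_borel_nonempty
      (fun (u : list nat) c => p c u /\ close_upto (code_structure c) n r u x)).
    intros u; apply (sigma_gen_and code_borel_nonempty); [apply Hp|apply code_borel_close_upto].
  - apply sg_compl, (sigma_gen_ForallOrdPairs code_borel_nonempty
      (fun (u v : list nat) c => ~ close_upto (code_structure c) n s u v)).
    intros u v; apply sg_compl, code_borel_close_upto.
Qed.

Lemma code_borel_label_holds l (p : Code L -> list nat -> Prop) (d : nat) (x : list nat) :
  (forall u, code_borel (fun c => p c u)) ->
  code_borel (fun c => label_holds (code_structure c) l (p c) d x).
Proof.
  intros Hp; destruct l as [|α z e|j r|j D e|n d0 k]; simpl.
  - apply code_borel_const.
  - apply code_borel_near.
  - unfold totally_bounded_ball; cbn [code_structure carrier].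
    apply (sigma_gen_ex code_borel_nonempty); [apply countable_nat|]; intros h.
    apply (sigma_gen_all code_borel_nonempty); [apply countable_nat|]; intros e.
    apply (sigma_gen_ex code_borel_nonempty); [apply countable_list, countable_nat|].
    intros u; apply code_borel_netted.
  - apply (sigma_gen_ex code_borel_nonempty); [apply countable_nat|]; intros h.
    apply code_borel_netted.
  - apply (sigma_gen_ex code_borel_nonempty); [apply countable_nat|]; intros h.
    now apply code_borel_packed.
Qed.

Lemma code_borel_piece lam (x y : list nat) :
  code_borel (fun c : Code L => piece (code_structure c) lam x y).
Proof.
  revert x y; induction lam as [|l lam IH]; intros x y.
  { apply (code_borel_const (x = [] /\ y = [])). }
  assert (Hadm : forall u : list nat, code_borel (fun c =>
    admissible (code_structure c) l (length lam) (piece (code_structure c) lam) u)).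
  { intros [|d u]; [apply (code_borel_const False)|].
    apply (sigma_gen_and code_borel_nonempty);
      [apply (code_borel_const (length (d :: u) = S (length lam)))|].
    apply (sigma_gen_and code_borel_nonempty);
      [apply (IH (firstn (length lam) (d :: u)) (firstn (length lam) (d :: u)))|].
    apply (code_borel_label_holds l (fun c =>
      piece (code_structure c) lam (firstn (length lam) (d :: u)))).
    intros v; apply IH. }
  apply (sigma_gen_and code_borel_nonempty); [apply Hadm|].
  apply (sigma_gen_clos_refl_trans (I := list nat) code_borel_nonempty (fun c =>
      piece_step (code_structure c) l (length lam) (piece (code_structure c) lam)));
    [apply countable_list, countable_nat|]; intros u v.
  repeat apply (sigma_gen_and code_borel_nonempty);
    [apply Hadm|apply Hadm|
    apply (IH (firstn (length lam) u) (firstn (length lam) v))|apply code_borel_close].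
Qed.

Lemma code_borel_below lam (x : list nat) lam' (x' : list nat) :
  code_borel (fun c : Code L => below (code_structure c) lam x lam' x').
Proof.
  repeat apply (sigma_gen_and code_borel_nonempty); 
    [apply (code_borel_const (suffix lam lam'))|apply (code_borel_piece lam' x' x')|].
  apply (code_borel_piece lam x (firstn (length lam) x')).
Qed.
End Borel.

Section Classification.
Context {L : signature}.

Lemma countable_node : countable (list (label L) * list nat).
Proof. auto using countable_prod, countable_list, countable_nat, countable_label. Qed.

Definition nodes : enumeration (list (label L) * list nat) :=
  countable_enumeration ([], []) countable_node.

Definition labels (m : nat) : list (label L) := fst (enum nodes m).

Definition tuple (m : nat) : list nat := snd (enum nodes m).

Lemma labels_index lam s k : labels (index nodes (lam, s) k) = lam.
Proof. unfold labels; now rewrite enum_index. Qed.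

Lemma tuple_index lam s k : tuple (index nodes (lam, s) k) = s.
Proof. unfold tuple; now rewrite enum_index. Qed.

Lemma countable_symbol : countable (option (list (label L))).
Proof. apply countable_option, countable_list, countable_label. Qed.

Definition tree_language : rel_language := {|
  Sym := option (list (label L));
  sym_code := proj1_sig (constructive_indefinite_description _ countable_symbol);
  sym_code_inj := proj2_sig (constructive_indefinite_description _ countable_symbol);
  sarity := fun s => match s with Some _ => 1%nat | None => 2%nat end |}.

Definition valid (c : Code L) (m : nat) : Prop :=
  piece (code_structure c) (labels m) (tuple m) (tuple m).

Definition labelled (c : Code L) (lam : list (label L)) (m : nat) : Prop :=
  labels m = lam /\ valid c m.

Definition child (c : Code L) (m m' : nat) : Prop :=
  (exists l, labels m' = l :: labels m) /\
  below (code_structure c) (labels m) (tuple m) (labels m') (tuple m').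

Definition symbol_holds (c : Code L) (s : Sym tree_language) :
    (Fin.t (sarity tree_language s) -> nat) -> Prop :=
  match s with
  | Some lam => fun v => labelled c lam (v Fin.F1)
  | None => fun v => child c (v Fin.F1) (v (Fin.FS Fin.F1))
  end.

Definition classify (c : Code L) : cstructure tree_language :=
  fun s v => if excluded_middle_informative (symbol_holds c s v) then true else false.

Lemma classify_true c s v : classify c s v = true <-> symbol_holds c s v.
Proof. unfold classify; now destruct excluded_middle_informative. Qed.

Lemma code_borel_symbol_holds s v : code_borel (fun c => symbol_holds c s v).
Proof.
  destruct s as [lam|]; simpl in *.
  - set (m := v Fin.F1); apply (sigma_gen_and code_borel_nonempty).
    + apply (code_borel_const (labels m = lam)).
    + apply (code_borel_piece (labels m) (tuple m) (tuple m)).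
  - set (m := v Fin.F1); set (m' := v (Fin.FS Fin.F1)).
    apply (sigma_gen_and code_borel_nonempty).
    + apply (code_borel_const (exists l, labels m' = l :: labels m)).
    + apply (code_borel_below (labels m) (tuple m) (labels m') (tuple m')).
Qed.

Lemma classify_borel (B : cstructure tree_language -> Prop) :
  cstructure_borel B -> code_borel (fun c : Code L => B (classify c)).
Proof.
  induction 1 as [A (s & v & HA)|A _ IH|A _ IH|A B _ IH HAB].
  - apply sg_ext with (1 := code_borel_symbol_holds s v).
    intros c; now rewrite HA, classify_true.
  - now apply sg_compl.
  - now apply sg_union.
  - now apply sg_ext with (1 := IH).
Qed.

Lemma ciso_classify (c c' : Code L) : ciso (classify c) (classify c') <->
  exists p q : nat -> nat, (forall m, q (p m) = m) /\ (forall m, p (q m) = m) /\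
    (forall lam m, labelled c lam m <-> labelled c' lam (p m)) /\
    (forall m m', child c m m' <-> child c' (p m) (p m')).
Proof.
  split; intros (p & q & Hqp & Hpq & Hp); exists p, q; (split; [easy|split; [easy|]]).
  - split; [intros lam m|intros m m'].
    + specialize (Hp (Some lam) (fun _ => m)); apply Bool.eq_iff_eq_true in Hp.
      rewrite !classify_true in Hp; symmetry; exact Hp.
    + specialize (Hp None (fun k => match k with Fin.F1 _ => m | _ => m' end)).
      apply Bool.eq_iff_eq_true in Hp; rewrite !classify_true in Hp; symmetry; exact Hp.
  - destruct Hp as [Hlab Hchild]; intros [lam|] v; apply Bool.eq_iff_eq_true;
      rewrite !classify_true; symmetry; [apply Hlab|apply Hchild].
Qed.

Section Invariance.
Context {M : structure L} {preM : prestructure M}.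

Definition same_piece (f g : nat -> M) (m m' : nat) : Prop :=
  labels m = labels m' /\ piece M (labels m) (map f (tuple m)) (map g (tuple m')).

Definition matching (c c' : Code L) (f g : nat -> M) (m m' : nat) : Prop :=
  same_piece f g m m' \/ (~ valid c m /\ ~ valid c' m').

Lemma matching_sym c c' f g m m' : matching c c' f g m m' -> matching c' c g f m' m.
Proof.
  intros [[E Hm]|[]]; [left|right; easy].
  split; [easy|]; rewrite <- E; now apply piece_sym.
Qed.

Context {c c' : Code L} {f g : nat -> M}.
Context (Hf : dense_embedding (code_structure c) M f).
Context (Hg : dense_embedding (code_structure c') M g).

Lemma matching_labelled lam m m' :
  matching c c' f g m m' -> labelled c lam m -> labelled c' lam m'.
Proof.
  intros [[E Hmm']|[Hm _]] [El V]; [|easy].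
  split; [congruence|]; apply (piece_transfer Hg); rewrite <- E.
  now apply piece_refl_r with (1 := Hmm').
Qed.

Lemma child_valid m m' : child c m m' -> valid c m /\ valid c m'.
Proof.
  intros (_ & _ & Hm' & Hm); split; [|easy].
  apply (piece_transfer Hf); apply (piece_transfer Hf) in Hm.
  now apply piece_refl_l with (1 := Hm).
Qed.

Lemma matching_child m1 m2 m1' m2' :
  matching c c' f g m1 m1' -> matching c c' f g m2 m2' -> child c m1 m2 -> child c' m1' m2'.
Proof.
  intros Hm1 Hm2 Hc; destruct (child_valid _ _ Hc) as [V1 V2].
  destruct Hm1 as [[E1 P1]|[]]; [|easy]; destruct Hm2 as [[E2 P2]|[]]; [|easy].
  destruct Hc as [Hl Hb]; split; [now rewrite <- E1, <- E2|].
  apply (below_transfer Hg); apply (below_transfer Hf) in Hb.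
  rewrite <- E1, <- E2; apply below_piece_r with (2 := P2).
  apply piece_sym in P1; now apply below_piece_l with (1 := P1).
Qed.

Lemma matching_exists : forall m, exists t, forall k, matching c c' f g m (index nodes t k).
Proof.
  intros m; destruct (classic (valid c m)) as [V|V].
  - apply (piece_transfer Hf) in V; destruct (dense_in_piece Hg _ _ V) as [s Hs].
    exists (labels m, s); intros k; left; split.
    + now rewrite labels_index.
    + now rewrite tuple_index.
  - exists ([], [O]); intros k; right; split; [easy|]; unfold valid.
    rewrite labels_index, tuple_index; now intros [].
Qed.
End Invariance.

Lemma classify_invariant (c c' : Code L) (M : structure L) (f g : nat -> M) :
  prestructure M -> dense_embedding (code_structure c) M f ->
  dense_embedding (code_structure c') M g -> ciso (classify c) (classify c').
Proof.
  intros preM Hf Hg.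
  destruct (choice _ (matching_exists Hf Hg)) as [t Ht].
  destruct (choice _ (matching_exists Hg Hf)) as [t' Ht'].
  destruct (Cantor_Bernstein_within (matching c c' f g) (fun m => index nodes (t m) m)
    (fun m => index nodes (t' m) m)) as (p & (q & Hqp & Hpq) & Hp).
  - intros m m'; apply index_inj.
  - intros m m'; apply index_inj.
  - intros m; apply Ht.
  - intros m; apply matching_sym, Ht'.
  - assert (Hp' := fun m => matching_sym _ _ _ _ _ _ (Hp m)).
    apply ciso_classify; exists p, q; split; [easy|]; split; [easy|].
    split; [intros lam m|intros m m']; split.
    + now apply (matching_labelled (f := f) Hg).
    + now apply (matching_labelled (f := g) Hf).
    + now apply (matching_child Hf Hg).
    + now apply (matching_child Hg Hf).
Qed.

Lemma codes_dense_embedding (c : Code L) M a :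
  codes c M a -> dense_embedding (code_structure c) M a.
Proof.
  intros (HM & Hdense & Hdist & Hinterp); split.
  - intros [i j|P v]; symmetry; [apply Hdist|apply Hinterp].
  - intros x e He; destruct (Hdense O x e He) as [m [_ Hm]]; now exists m.
Qed.

Lemma isoT_ciso (c c' : Code L) : isoT c c' -> ciso (classify c) (classify c').
Proof.
  intros (M & M' & a & a' & Hc & Hc' & g & Hsurj & Hdist & Hinterp).
  apply classify_invariant with M' (fun n => g (a n)) a'.
  - apply polish_prestructure, Hc'.
  - apply dense_embedding_isometry with M; auto using codes_dense_embedding.
  - now apply codes_dense_embedding.
Qed.
End Classification.
Arguments nodes : clear implicits.
Arguments tuple : clear implicits.

(** * Stabilisation *)

Section Stability.
Context {L : signature} {M : structure L} {preM : prestructure M}.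

Definition almost_locally_totally_bounded : Prop :=
  forall x e, 0 < e -> exists y r, dist M x y < e /\ totally_bounded_ball M y (eps r).

Lemma almost_locally_compact_totally_bounded :
  almost_locally_compact M -> almost_locally_totally_bounded.
Proof.
  intros (D & HD & HL) x e He.
  destruct (HD x e He) as [y [Hy Hxy]].
  destruct (HL y Hy) as (K & d & Hd & HK & _ & HDK).
  destruct (exists_eps_lt d Hd) as [r Hr]; exists y, r; split; [easy|]; intros q.
  destruct (HK M (fun c z => dist M c z < eps (S q))) as [u Hu].
  - intros c z Hz; exists (eps (S q) - dist M c z); split; [lra|]; intros z' Hz'.
    pose proof (dist_triangle c z z'); lra.
  - intros z _; exists z; rewrite dist_refl; apply eps_pos.
  - exists u; intros z Hz.
    destruct (eventually_and_ex _ _ (eventually_ge (S q))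
      (eventually_eps_lt (d - dist M y z) ltac:(lra))) as [n [Hn Hnd]].
    destruct (HD z (eps n) (eps_pos n)) as [k [Hk Hzk]].
    destruct (Hu k) as [c [Hc Hck]].
    { apply HDK; [easy|]; pose proof (dist_triangle y z k); lra. }
    exists c; split; [easy|]; rewrite dist_sym in Hzk.
    pose proof (dist_triangle c k z); pose proof (eps_le _ _ Hn); rewrite eps_S in *; lra.
Qed.

Lemma totally_bounded_tuple_dense x e : almost_locally_totally_bounded -> 0 < e ->
  exists w r, close M e x w /\ Forall (fun z => totally_bounded_ball M z (eps r)) w.
Proof.
  intros HM He; induction x as [|a x (w & r & Hw & Hr)].
  - exists [], O; split; constructor.
  - destruct (HM a e He) as (b & s & Hb & Hs); exists (b :: w), (Nat.max r s).
    split; [now constructor|]; constructor.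
    + apply totally_bounded_ball_le with (eps s); [easy|apply eps_le; lia].
    + apply Forall_impl with (2 := Hr); intros z Hz.
      apply totally_bounded_ball_le with (eps r); [easy|apply eps_le; lia].
Qed.

Lemma totally_bounded_tuple_net r w e : Forall (fun z => totally_bounded_ball M z r) w ->
  exists F, forall v, close M r v w -> exists g, In g F /\ close M (eps e) g v.
Proof.
  induction 1 as [|a w Ha _ [F HF]].
  - exists [[]]; intros v Hv; inversion Hv; exists []; split; [now left|constructor].
  - destruct (Ha e) as [F0 HF0]; exists (map (fun p => fst p :: snd p) (list_prod F0 F)).
    intros v Hv; inversion Hv as [|b ? v' ? Hb Hv']; subst.
    destruct (HF v' Hv') as [g [Hg Hgv]].
    destruct (HF0 b) as [y [Hy Hyb]]; [now rewrite dist_sym|].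
    exists (y :: g); split; [|now constructor].
    apply in_map_iff; exists (y, g); split; [easy|]; now apply in_prod.
Qed.

Lemma packed_exists n r s w : Forall (fun z => totally_bounded_ball M z r) (firstn n w) ->
  0 < s -> exists k, forall p, packed M p n r s k w.
Proof.
  intros Hw Hs; destruct (exists_eps_lt (s / 2) ltac:(lra)) as [e He].
  destruct (totally_bounded_tuple_net r (firstn n w) e Hw) as [F HF].
  exists (S (length F)); intros p us Hlen Hus Hsep.
  enough (length us <= length F)%nat by lia.
  apply pigeonhole with (R := fun u g => close M (eps e) g (firstn n u)).
  - apply Forall_impl with (2 := Hus); intros u [_ Hu]; now apply HF.
  - apply ForallOrdPairs_impl with (2 := Hsep); intros u v Hn (g & Hu & Hv); apply Hn.
    apply close_mono with (eps e + eps e); [lra|].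
    apply close_trans with g; [now apply close_sym|easy].
Qed.

Lemma packed_remove p q n r s k x v : packed M p n r s k x ->
  (forall u, q u -> p u) -> p v -> close_upto M n r v x ->
  (forall u, q u -> ~ close_upto M n s v u) ->
  exists j, k = S j /\ packed M q n r s j x.
Proof.
  intros Hk Hqp Hv Hvx Hfar; destruct k as [|j].
  - destruct (Hk [] eq_refl); constructor.
  - exists j; split; [easy|]; intros us Hlen Hus Hsep; apply (Hk (v :: us)).
    + simpl; congruence.
    + constructor; [easy|]; apply Forall_impl with (2 := Hus); intros u []; auto.
    + constructor; [|easy]; apply Forall_impl with (2 := Hus); intros u []; auto.
Qed.

Lemma close_upto_firstn n m r u v : (n <= m)%nat ->
  close_upto M n r (firstn m u) v <-> close_upto M n r u v.
Proof. intros Hnm; unfold close_upto; now rewrite firstn_firstn, Nat.min_l. Qed.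

Lemma below_piece lam x lam' x' u : below M lam x lam' x' -> piece M lam' x' u ->
  piece M lam x (firstn (length lam) u).
Proof. intros Hx' Hu; now destruct (below_piece_r _ _ _ _ _ Hx' Hu). Qed.

Lemma below_snoc l lam x b : piece M lam x x ->
  label_holds M l (piece M lam x) (hd b x) (x ++ [b]) -> below M lam x (l :: lam) (x ++ [b]).
Proof.
  intros Hx Hc; pose proof (piece_length_l _ _ _ Hx) as Hlen.
  assert (Hparent : firstn (length lam) (x ++ [b]) = x)
    by (rewrite <- Hlen, firstn_app, Nat.sub_diag, firstn_all; apply app_nil_r).
  rewrite <- Hparent at 1; apply below_child, piece_intro.
  assert (Hlen' : length (x ++ [b]) = S (length lam)) by (rewrite length_app; simpl; lia).
  unfold admissible; rewrite Hparent; destruct x; easy.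
Qed.

Lemma below_free lam x bs : piece M lam x x -> exists lam', below M lam x lam' (x ++ bs).
Proof.
  intros Hx; induction bs as [|b bs [lam' IH]] using rev_ind.
  - exists lam; rewrite app_nil_r; now apply below_refl.
  - exists (Free :: lam'); rewrite app_assoc; apply below_trans with (1 := IH).
    now apply below_snoc; [apply IH|].
Qed.

Definition stable (n d : nat) (lam : list (label L)) (x : list M) : Prop :=
  forall lam' x', below M lam x lam' x' -> forall u, piece M lam x u ->
    exists u', piece M lam' x' u' /\ close_upto M n (eps d) u u'.

Lemma stable_below n d lam x lam' x' : (n <= length lam)%nat -> stable n d lam x ->
  below M lam x lam' x' -> stable n d lam' x'.
Proof.
  intros Hn HS Hx' lam'' x'' Hx'' u Hu.
  destruct (HS lam'' x'' (below_trans _ _ _ _ _ _ Hx' Hx'') (firstn (length lam) u))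
    as [u'' [Hu'' Hc]]; [now apply below_piece with lam' x'|].
  exists u''; split; [easy|]; now apply close_upto_firstn in Hc.
Qed.

Lemma stable_0 d lam x : stable 0 d lam x.
Proof. intros lam' x' Hx' u _; exists x'; split; [apply Hx'|constructor]. Qed.

Definition packing_bound (lam : list (label L)) (x : list M) (n d k : nat) : Prop :=
  exists h, packed M (piece M lam x) n (2 * eps d + eps h) (eps d - eps h) k x.

Lemma packing_bound_below_exists (b : M) lam x n N : almost_locally_totally_bounded ->
  piece M lam x x -> (n <= length lam)%nat ->
  exists d k lam' x', (N <= d <= length lam')%nat /\ below M lam x lam' x' /\
    packing_bound lam' x' n d k.
Proof.
  intros HM Hx Hn; destruct (piece_open lam x x Hx) as [m Hm].
  destruct (totally_bounded_tuple_dense x (eps m) HM (eps_pos m)) as (w & r & Hxw & Hr).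
  pose proof (Hm m (le_n m) w Hxw) as Hw; pose proof (piece_length_r _ _ _ Hw) as Hlw.
  set (d := (N + r + 2)%nat).
  assert (Hd : 4 * eps d <= eps r).
  { assert (Hle : eps d <= eps (S (S r))) by (apply eps_le; unfold d; lia).
    rewrite !eps_S in Hle; lra. }
  destruct (below_free lam w (repeat b d)) as [lam' Hb]; [now apply piece_refl_r with x|].
  destruct (packed_exists n (eps r) (eps d - eps (S d)) (w ++ repeat b d)) as [k Hk].
  { rewrite firstn_app; replace (n - length w)%nat with O by lia; rewrite app_nil_r.
    rewrite <- (firstn_skipn n w) in Hr; now apply Forall_app in Hr. }
  { rewrite eps_S; pose proof (eps_pos d); lra. }
  exists d, k, lam', (w ++ repeat b d); split; [|split].
  - destruct Hb as (_ & Hb & _); apply piece_length_l in Hb.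
    rewrite length_app, repeat_length in Hb; unfold d in *; lia.
  - now apply below_piece_l with w.
  - exists (S d); generalize (Hk (piece M lam' (w ++ repeat b d))).
    apply packed_mono; [easy| |lra].
    intros u; apply close_mono; rewrite eps_S; pose proof (eps_pos d); lra.
Qed.

Lemma packing_label_packed n d k lam x lam' x' : (n <= length lam)%nat ->
  below M (Packing n d k :: lam) x lam' x' ->
  exists h, packed M (fun u => piece M (Packing n d k :: lam) x (firstn (S (length lam)) u))
    n (2 * eps d + eps h) (eps d - eps h) k x'.
Proof.
  intros Hn (_ & _ & Hx); pose proof (piece_sym _ _ _ Hx) as Hadm.
  apply piece_admissible_l, admissible_label_holds in Hadm; destruct Hadm as (d0 & h & Hh).
  exists h; revert Hh.
  apply packed_transport with (T := fun u u' => u = firstn (length lam) u').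
  - intros u Hu Hux; exists (firstn (length lam) u); split; [split|easy].
    + apply (piece_trans _ _ _ _ (piece_sym _ _ _ Hx)) in Hu; apply piece_parent in Hu.
      rewrite (firstn_firstn u), Nat.min_l in Hu by lia; exact Hu.
    + apply close_upto_firstn; [easy|]; apply close_upto_sym, close_upto_firstn; [simpl; lia|].
      now apply close_upto_sym.
  - intros u v u' v' -> -> Huv; apply close_upto_firstn in Huv; [|easy].
    apply close_upto_sym, close_upto_firstn in Huv; [|easy]; now apply close_upto_sym.
Qed.

(* Along a chain in the piece, a first point far from the pieces below would contribute one more
   separated tuple than the minimal packing number allows. *)
Lemma minimal_packing_stable n d k lam x : (n <= length lam)%nat -> (d <= length lam)%nat ->
  piece M (Packing n d k :: lam) x x ->
  (forall lam' x' j, below M (Packing n d k :: lam) x lam' x' ->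
    packing_bound lam' x' n d j -> (k <= j)%nat) ->
  stable n d (Packing n d k :: lam) x.
Proof.
  intros Hn Hd Hx Hmin lam' x' Hx' u Hu; set (lam1 := Packing n d k :: lam) in *.
  set (u0 := firstn (length lam1) x'); pose proof (eps_pos d) as Hpos.
  assert (Hx0 : piece M lam1 x u0) by apply Hx'.
  pose proof (piece_trans _ _ _ _ (piece_sym _ _ _ Hx0) Hu) as [Hadm Hchain]; clear Hu.
  induction Hchain as [|v w Hv IH Hvw] using clos_refl_trans_ind_left.
  - exists x'; split; [apply Hx'|]; apply close_upto_firstn; [simpl; lia|].
    now apply close_refl.
  - destruct IH as [v' [Hv' Hvv']]; apply NNPP; intros Hfar.
    pose proof (below_piece_r _ _ _ _ _ Hx' Hv') as Hb.
    assert (Hw : piece M lam1 x w).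
    { apply piece_trans with (1 := Hx0); split; [easy|].
      apply rt_trans with v; [easy|now apply rt_step]. }
    destruct (packing_label_packed _ _ _ _ _ _ _ Hn Hb) as [h Hh]; pose proof (eps_pos h).
    destruct (packed_remove _ (piece M lam' v') _ _ _ _ _ w Hh) as (j & -> & Hj).
    + intros z Hz; now apply (below_piece _ _ _ _ _ Hb).
    + now rewrite firstn_all2 by (apply piece_length_r in Hw; simpl in Hw; lia).
    + apply close_mono with (eps d + eps d); [lra|].
      apply close_upto_trans with v; [|easy]; apply close_upto_sym, Forall2_firstn.
      apply close_mono with (eps (length lam)); [now apply eps_le|apply Hvw].
    + intros z Hz Hwz; apply Hfar; exists z; split; [now apply piece_trans with v'|].
      apply close_mono with (2 := Hwz); lra.
    + specialize (Hmin lam' v' j Hb (ex_intro _ h Hj)); lia.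
Qed.

Lemma stable_below_exists (b : M) lam x n N : almost_locally_totally_bounded ->
  piece M lam x x -> (n <= length lam)%nat ->
  exists d lam' x', (N <= d)%nat /\ below M lam x lam' x' /\
    (length lam < length lam')%nat /\ stable n d lam' x'.
Proof.
  intros HM Hx Hn.
  destruct (packing_bound_below_exists b lam x n N HM Hx Hn)
    as (d & k0 & lam0 & x0 & [HN Hd0] & Hb0 & Hk0).
  destruct (dec_inh_nat_subset_has_unique_least_element (fun k => exists lam' x',
    (d <= length lam')%nat /\ below M lam x lam' x' /\ packing_bound lam' x' n d k))
    as (k & [(lam1 & x1 & Hd1 & Hb1 & h & Hk) Hmin] & _).
  - intros j; apply classic.
  - now exists k0, lam0, x0.
  - pose proof (suffix_length _ _ (proj1 Hb1)) as Hlen.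
    assert (Hb : below M lam1 x1 (Packing n d k :: lam1) (x1 ++ [b])).
    { apply below_snoc; [apply Hb1|]; exists h.
      revert Hk; apply packed_mono; [easy| |lra]; intros u Hux.
      destruct Hb1 as (_ & Hx1 & _); apply piece_length_l in Hx1.
      unfold close_upto in *; rewrite firstn_app in Hux.
      now replace (n - length x1)%nat with O in Hux by lia; rewrite app_nil_r in Hux. }
    pose proof (below_trans _ _ _ _ _ _ Hb1 Hb) as Hb2.
    exists d, (Packing n d k :: lam1), (x1 ++ [b]); split; [easy|].
    split; [easy|]; split; [simpl; lia|].
    apply minimal_packing_stable; [lia|easy|apply Hb|].
    intros lam' x' j Hb' Hj; apply Hmin; exists lam', x'.
    split; [|split; [now apply below_trans with (1 := Hb2)|easy]].
    apply proj1, suffix_length in Hb'; simpl in Hb'; lia.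
Qed.
End Stability.
Arguments almost_locally_totally_bounded {L} M.

(** * Requirements met along a branch *)

Inductive task (L : signature) : Type :=
| Approach (m q : nat)
| Cover (j D e : nat)
| Decide (α : atom L nat) (c : nat).
Arguments Approach {L}.
Arguments Cover {L}.
Arguments Decide {L}.

Lemma countable_task (L : signature) : countable (task L).
Proof.
  apply (@countable_inj _ (nat * nat + nat * nat * nat + atom L nat * nat) (fun τ => match τ with
    | Approach m q => inl (inl (m, q))
    | Cover j D e => inl (inr (j, D, e))
    | Decide α c => inr (α, c)
    end)).
  - intros [] [] E; try discriminate E; injection E; intros; subst; easy.
  - auto 10 using countable_sum, countable_prod, countable_nat, countable_atom.
Qed.

Section Tasks.
Context {L : signature} {M : structure L} {preM : prestructure M} (a : nat -> M).

(* The bound [r + 3] keeps the steps of the piece below an eighth of the radius [eps r]. *)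
Definition task_done (τ : task L) (x : list M) (lam' : list (label L)) (x' : list M) : Prop :=
  match τ with
  | Approach m q => exists w r lam1 x1, dist M (a m) w < eps q /\
      (r + 3 <= length lam1)%nat /\ length x1 = length lam1 /\
      below M (Ball (length lam1) r :: lam1) (x1 ++ [w]) lam' x'
  | Cover j D e => (j < length x)%nat ->
      (exists h, totally_bounded_ball M (nth j x (a O)) (eps D + eps h)) ->
      exists lam1, (length x <= length lam1)%nat /\ suffix (Net j D e :: lam1) lam'
  | Decide α c =>
      exists lam1 z, (length x <= length lam1)%nat /\ suffix (Value α z c :: lam1) lam'
  end.

Lemma task_done_below τ x lam' x' lam'' x'' :
  task_done τ x lam' x' -> below M lam' x' lam'' x'' -> task_done τ x lam'' x''.
Proof.
  intros Hdone Hb; pose proof (proj1 Hb) as Hs; destruct τ as [m q|j D e|α c]; simpl in *.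
  - destruct Hdone as (w & r & lam1 & x1 & Hw & Hr & Hlen & Hx').
    exists w, r, lam1, x1; split; [easy|]; split; [easy|]; split; [easy|].
    now apply below_trans with lam' x'.
  - intros Hj HB; destruct (Hdone Hj HB) as (lam1 & Hlen & Hlam1).
    exists lam1; split; [easy|now apply suffix_trans with lam'].
  - destruct Hdone as (lam1 & z & Hlen & Hlam1).
    exists lam1, z; split; [easy|now apply suffix_trans with lam'].
Qed.

Lemma below_length lam x lam' x' : below M lam x lam' x' -> (length lam <= length lam')%nat.
Proof. intros [Hs _]; now apply suffix_length. Qed.

Lemma approach_exists m q lam x : almost_locally_totally_bounded M ->
  piece M lam x x -> exists lam' x', below M lam x lam' x' /\ task_done (Approach m q) x lam' x'.
Proof.
  intros HM Hx; destruct (HM (a m) (eps q) (eps_pos q)) as (w & r & Hw & Hr).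
  destruct (below_free lam x (repeat w (r + 4)) Hx) as [lam1 Hb].
  pose proof (piece_length_l _ _ _ (proj1 (proj2 Hb))) as Hlen.
  assert (Hlam1 : (r + 4 <= length lam1)%nat)
    by (rewrite <- Hlen, length_app, repeat_length; lia).
  set (x1 := x ++ repeat w (r + 4)) in *.
  assert (Hb1 : below M lam1 x1 (Ball (length lam1) (S r) :: lam1) (x1 ++ [w])).
  { apply below_snoc; [apply Hb|]; exists (S r).
    rewrite app_nth2, Hlen, Nat.sub_diag by lia; simpl nth.
    apply totally_bounded_ball_le with (eps r); [easy|rewrite eps_S; lra]. }
  exists (Ball (length lam1) (S r) :: lam1), (x1 ++ [w]).
  split; [now apply below_trans with (1 := Hb)|].
  exists w, (S r), lam1, x1; split; [easy|]; split; [lia|]; split; [easy|].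
  eapply below_refl, Hb1.
Qed.

Lemma cover_exists j D e lam x : piece M lam x x ->
  exists lam' x', below M lam x lam' x' /\ task_done (Cover j D e) x lam' x'.
Proof.
  intros Hx; destruct (classic ((j < length x)%nat /\
    exists h, totally_bounded_ball M (nth j x (a O)) (eps D + eps h))) as [[Hj [h Hh]]|Hn].
  2:{ exists lam, x; split; [eapply below_refl, Hx|].
      intros Hj Hh; destruct Hn; now split. }
  destruct (Hh (S e)) as [F HF]; destruct (below_free lam x F Hx) as [lam1 Hb].
  pose proof (piece_length_l _ _ _ (proj1 (proj2 Hb))) as Hlen; rewrite length_app in Hlen.
  exists (Net j D e :: lam1), ((x ++ F) ++ [a O]); split.
  - apply below_trans with (1 := Hb), below_snoc; [apply Hb|]; exists (S (h + e)).
    rewrite <- app_assoc, app_nth1, (nth_indep _ _ (a O)) by easy.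
    assert (Hle : eps (S (h + e)) <= eps (S e) /\ eps (S (h + e)) <= eps h)
      by (split; apply eps_le; lia).
    intros z Hz; destruct (HF z) as [y [Hy Hyz]]; [lra|]; exists y.
    split; [apply in_or_app; right; apply in_or_app; now left|rewrite (eps_S e) in *; lra].
  - intros _ _; exists lam1; split; [lia|apply suffix_refl].
Qed.

Lemma decide_exists α c lam x : piece M lam x x ->
  exists lam' x', below M lam x lam' x' /\ task_done (Decide α c) x lam' x'.
Proof.
  intros Hx; pose proof (piece_length_l _ _ _ Hx) as Hlen.
  destruct (near_exists (atom_value M (fun i => nth i (x ++ [a O]) (hd (a O) x)) α) c)
    as [z Hz].
  exists (Value α z c :: lam), (x ++ [a O]); split; [now apply below_snoc|].
  exists lam, z; split; [lia|apply suffix_refl].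
Qed.

Lemma task_done_exists τ lam x : almost_locally_totally_bounded M -> piece M lam x x ->
  exists lam' x', below M lam x lam' x' /\ task_done τ x lam' x'.
Proof.
  intros HM Hx; destruct τ as [m q|j D e|α c].
  - now apply approach_exists.
  - now apply cover_exists.
  - now apply decide_exists.
Qed.

Lemma suffix_label_holds l lam1 lam x : piece M lam x x -> suffix (l :: lam1) lam ->
  exists p d, label_holds M l p d (firstn (S (length lam1)) x).
Proof.
  intros Hx Hs; apply (piece_firstn _ _ _ _ Hs) in Hx.
  apply piece_admissible_l, admissible_label_holds in Hx; destruct Hx as [d Hd].
  eexists; exists d; exact Hd.
Qed.

Lemma admissible_ball j r n E x d : (j <= n)%nat -> admissible M (Ball j r) n E x ->
  exists h, totally_bounded_ball M (nth j x d) (eps r + eps h).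
Proof.
  intros Hj Hx; destruct x as [|d0 x]; [easy|]; destruct Hx as (Hlen & _ & h & Hh).
  exists h; rewrite (nth_indep _ d d0); [easy|lia].
Qed.
End Tasks.

(** * Limits along a branch *)

Lemma geometric_limit {L} (M : structure L) (u : nat -> M) t0 : polish M ->
  (forall t, (t0 <= t)%nat -> dist M (u t) (u (S t)) < eps t) ->
  exists y, forall t, (t0 <= t)%nat -> dist M (u t) y <= 2 * eps t.
Proof.
  intros HM Hu.
  assert (Hgeom : forall t t', (t0 <= t <= t')%nat ->
    dist M (u t) (u t') <= 2 * eps t - 2 * eps t').
  { intros t t' [Ht Htt']; induction Htt' as [|t' Htt' IH]; [rewrite dist_refl; lra|].
    pose proof (Hu t' ltac:(lia)); pose proof (dist_triangle (u t) (u t') (u (S t'))).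
    rewrite eps_S; lra. }
  destruct (polish_complete M (fun s => u (t0 + s)%nat) HM) as [y Hy].
  { intros e He; destruct (eventually_eps_lt (e / 4) ltac:(lra)) as [N HN].
    exists N; intros s s' Hs Hs'; specialize (HN (t0 + N)%nat ltac:(lia)).
    pose proof (Hgeom (t0 + N) (t0 + s) ltac:(lia))%nat as Hls.
    pose proof (Hgeom (t0 + N) (t0 + s') ltac:(lia))%nat as Hls'.
    rewrite dist_sym in Hls; pose proof (eps_pos (t0 + s)); pose proof (eps_pos (t0 + s')).
    pose proof (dist_triangle (u (t0 + s)) (u (t0 + N)) (u (t0 + s')))%nat; lra. }
  exists y; intros t Ht; apply le_epsilon; intros e He.
  destruct (Hy e He) as [N HN]; specialize (HN (N + t)%nat ltac:(lia)).
  pose proof (Hgeom t (t0 + (N + t)) ltac:(lia))%nat; pose proof (eps_pos (t0 + (N + t))).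
  pose proof (dist_triangle (u t) (u (t0 + (N + t))) y)%nat; lra.
Qed.

Section GenericBranch.
Context {L : signature} {M : structure L} {polishM : polish M} (a : nat -> M).

(* The first [n t] coordinates of [x t] are settled: later ones stay within [2 * eps t] of them. *)
Record generic_branch (lam : nat -> list (label L)) (x : nat -> list M) (n : nat -> nat)
    : Prop := {
  branch_below : forall t, below M (lam t) (x t) (lam (S t)) (x (S t));
  branch_settled_le : forall t, (n t <= length (lam t))%nat;
  branch_settled_S : forall t, n (S t) = length (lam t);
  branch_length_lt : forall t, (length (lam t) < length (lam (S t)))%nat;
  branch_close : forall t, close_upto M (n t) (eps t) (x t) (x (S t));
  branch_done : forall τ N, exists t, (N <= t)%nat /\ task_done a τ (x t) (lam (S t)) (x (S t)) }.

Context {lam : nat -> list (label L)} {x : nat -> list M} {n : nat -> nat}.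
Context (Hbranch : generic_branch lam x n).

Let X (t i : nat) : M := nth i (x t) (a O).

Lemma branch_valid t : piece M (lam t) (x t) (x t).
Proof. destruct (branch_below _ _ _ Hbranch t) as (_ & _ & Hx); now apply piece_refl_l in Hx. Qed.

Lemma branch_length t : length (x t) = length (lam t).
Proof. apply (piece_length_l _ _ _ (branch_valid t)). Qed.

Lemma branch_below_le t t' : (t <= t')%nat -> below M (lam t) (x t) (lam t') (x t').
Proof.
  induction 1 as [|t' _ IH]; [eapply below_refl, branch_valid|].
  apply below_trans with (1 := IH), (branch_below _ _ _ Hbranch).
Qed.

Lemma branch_settled_mono t t' : (t <= t')%nat -> (n t <= n t')%nat.
Proof.
  induction 1 as [|t' _ IH]; [lia|].
  rewrite (branch_settled_S _ _ _ Hbranch); pose proof (branch_settled_le _ _ _ Hbranch t'); lia.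
Qed.

Lemma eventually_settled K : eventually (fun t => (K <= n t)%nat).
Proof.
  assert (Hlen : forall t, (t <= length (lam t))%nat).
  { induction t as [|t IH]; [lia|]; pose proof (branch_length_lt _ _ _ Hbranch t); lia. }
  exists (S K); intros [|t] Ht; [lia|].
  rewrite (branch_settled_S _ _ _ Hbranch); specialize (Hlen t); lia.
Qed.

Lemma branch_step_dist t i : (i < n t)%nat -> dist M (X t i) (X (S t) i) < eps t.
Proof.
  intros Hi; pose proof (close_nth _ _ _ _ i (a O) (a O) (branch_close _ _ _ Hbranch t)) as Hdist.
  rewrite !nth_firstn, dist_refl in Hdist; apply Nat.ltb_lt in Hi; rewrite Hi in Hdist.
  apply Hdist, eps_pos.
Qed.

Lemma branch_limit : exists l : nat -> M, forall i t, (i < n t)%nat ->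
  dist M (X t i) (l i) <= 2 * eps t.
Proof.
  apply (choice (fun i y => forall t, (i < n t)%nat -> dist M (X t i) y <= 2 * eps t)).
  intros i; destruct (dec_inh_nat_subset_has_unique_least_element (fun t => i < n t)%nat)
    as (t0 & [Ht0 Hmin] & _).
  - intros t; apply classic.
  - destruct (eventually_settled (S i)) as [t Ht]; exists t; now apply (Ht t).
  - destruct (geometric_limit M (fun t => X t i) t0 polishM) as [y Hy].
    + intros t Ht; apply branch_step_dist; pose proof (branch_settled_mono _ _ Ht); lia.
    + exists y; intros t Ht; now apply Hy, Hmin.
Qed.

Context {l : nat -> M}.
Context (Hl : forall i t, (i < n t)%nat -> dist M (X t i) (l i) <= 2 * eps t).

Lemma eventually_limit K r : 0 < r ->
  eventually (fun t => forall i, (i < K)%nat -> dist M (X t i) (l i) < r).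
Proof.
  intros Hr; apply filter_imp with (2 := filter_and _ _ (eventually_settled K)
    (eventually_eps_lt (r / 2) ltac:(lra))).
  intros t [HK Ht] i Hi; pose proof (Hl i t ltac:(lia)); lra.
Qed.

Lemma eventually_atom_limit α e : 0 < e -> eventually (fun t =>
  Rabs (atom_value M (X t) α - atom_value M l α) < e).
Proof.
  intros He; destruct (atom_uses_bounded α) as [K HK].
  destruct (atom_value_continuous (M := M) α e He) as [m Hm].
  apply filter_imp with (2 := eventually_limit K (eps m) (eps_pos m)).
  intros t Ht; apply (Hm m (le_n m)); intros i Hi; now apply Ht, (HK K).
Qed.

Lemma branch_value α z c lam1 t : suffix (Value α z c :: lam1) (lam t) ->
  (forall i, atom_uses α i -> (i < length lam1)%nat) -> near (atom_value M (X t) α) z c.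
Proof.
  intros Hs Hα; destruct (suffix_label_holds _ _ _ _ (branch_valid t) Hs) as (p & d & Hnear).
  pose proof (suffix_length _ _ Hs) as Hlen; rewrite <- branch_length in Hlen; simpl in *.
  rewrite (atom_value_ext α (X t) (fun i => nth i (firstn (S (length lam1)) (x t)) d));
    [easy|].
  intros i Hi; apply Hα in Hi; symmetry; apply nth_firstn_indep; lia.
Qed.

Lemma branch_net j D e lam1 t z : suffix (Net j D e :: lam1) (lam t) ->
  (j < length lam1)%nat -> dist M (X t j) z < eps D ->
  exists i, (i <= length lam1)%nat /\ dist M (X t i) z < eps e.
Proof.
  intros Hs Hj Hz; destruct (suffix_label_holds _ _ _ _ (branch_valid t) Hs) as (p & d & h & Hnet).
  pose proof (suffix_length _ _ Hs) as Hlen; rewrite <- branch_length in Hlen; simpl in Hlen.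
  pose proof (eps_pos h); destruct (Hnet z) as [y [Hy Hyz]].
  - rewrite (nth_firstn_indep _ _ _ d (a O)) by lia; fold (X t j); lra.
  - destruct (In_nth _ _ (a O) Hy) as [i [Hi <-]]; rewrite firstn_length_le in Hi by lia.
    exists i; split; [lia|]; rewrite (nth_firstn_indep _ _ _ _ (a O)) in Hyz by lia.
    fold (X t i) in Hyz; lra.
Qed.

Lemma adherent_in_ball j D h z : totally_bounded_ball M (l j) (eps D + eps h) ->
  dist M (l j) z < eps D -> adherent l z.
Proof.
  intros HB Hz e He; destruct (exists_eps_lt (e / 2) ltac:(lra)) as [q Hq].
  destruct (filter_and _ _ (eventually_settled (S j))
    (eventually_limit (S j) (eps (S h)) (eps_pos _))) as [N HN].
  destruct (branch_done _ _ _ Hbranch (Cover j D q) N) as [t [Ht Hdone]].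
  destruct (HN t Ht) as [Hjt Hlt]; pose proof (branch_settled_le _ _ _ Hbranch t) as Hle.
  pose proof (branch_length t) as Hlen; destruct Hdone as (lam1 & Hlam1 & Hs); [lia| |].
  { exists (S h); apply totally_bounded_ball_move with (1 := HB); fold (X t j).
    specialize (Hlt j (le_n _)); rewrite dist_sym in Hlt; rewrite eps_S in *; lra. }
  destruct (eventually_and_ex _ _ (eventually_ge (S t)) (eventually_limit (S (length lam1))
    (Rmin (e / 2) (eps D - dist M (l j) z)) ltac:(apply Rmin_pos; lra))) as (t' & Ht' & Hlt').
  pose proof (Rmin_l (e / 2) (eps D - dist M (l j) z)).
  pose proof (Rmin_r (e / 2) (eps D - dist M (l j) z)).
  destruct (branch_net j D q lam1 t' z) as (i & Hi & Hiz).
  - apply suffix_trans with (1 := Hs), (branch_below_le _ _ Ht').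
  - lia.
  - pose proof (Hlt' j ltac:(lia)); pose proof (dist_triangle (X t' j) (l j) z); lra.
  - exists i; pose proof (Hlt' i ltac:(lia)) as Hil; rewrite dist_sym in Hil.
    pose proof (dist_triangle (l i) (X t' i) z); lra.
Qed.

Lemma adherent_spread j r h b b' : totally_bounded_ball M b (eps r + eps h) ->
  dist M (l j) b < eps (r + 3) -> dist M b b' < eps (r + 3) -> adherent l b'.
Proof.
  intros HB Hj Hb; pose proof (eps_pos h); pose proof (eps_pos r).
  rewrite !Nat.add_succ_r, Nat.add_0_r, !eps_S in Hj, Hb.
  apply adherent_in_ball with j (S r) (S (S r)).
  - apply totally_bounded_ball_move with (1 := HB); rewrite dist_sym, !eps_S; lra.
  - pose proof (dist_triangle (l j) b b'); rewrite eps_S; lra.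
Qed.

(* Each step stays in a totally bounded ball around a limit point, which the nets cover. *)
Lemma adherent_chain r lam1 u v : let E := piece M lam1 in let K := length lam1 in
  (r + 3 <= K)%nat -> admissible M (Ball K r) K E u ->
  (exists j, dist M (l j) (nth K u (a O)) < eps (r + 3)) ->
  clos_refl_trans _ (piece_step M (Ball K r) K E) u v -> adherent l (nth K v (a O)).
Proof.
  intros E K HK Hu [j Hj] Hv; pose proof (eps_pos (r + 3)) as Hpos.
  induction Hv as [|v w _ IH (Hv & _ & _ & Hvw)] using clos_refl_trans_ind_left.
  - destruct (admissible_ball _ _ _ _ _ (a O) (le_n K) Hu) as [h Hh].
    apply adherent_spread with (1 := Hh) (2 := Hj); now rewrite dist_refl.
  - destruct (admissible_ball _ _ _ _ _ (a O) (le_n K) Hv) as [h Hh].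
    destruct (IH _ Hpos) as [i Hi]; apply adherent_spread with (1 := Hh) (2 := Hi).
    apply close_nth; [|now rewrite dist_refl].
    apply close_mono with (2 := Hvw); now apply eps_le.
Qed.

Lemma branch_dense : dense_family a -> dense_family l.
Proof.
  intros Ha z e He; destruct (Ha z (e / 3) ltac:(lra)) as [m Hm].
  destruct (exists_eps_lt (e / 3) ltac:(lra)) as [q Hq].
  destruct (branch_done _ _ _ Hbranch (Approach m q) O)
    as (t & _ & w & r & lam1 & x1 & Hw & Hr & Hlen & Hb); set (K := length lam1) in *.
  enough (Hadh : adherent l w).
  { destruct (Hadh (e / 3) ltac:(lra)) as [i Hi]; exists i; rewrite dist_sym in Hw.
    pose proof (dist_triangle (l i) w z); pose proof (dist_triangle w (a m) z); lra. }
  destruct (eventually_and_ex _ _ (eventually_ge (S t))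
    (eventually_limit (S K) (eps (r + 3)) (eps_pos _))) as (t' & Ht' & Hlt').
  pose proof (below_trans _ _ _ _ _ _ Hb (branch_below_le _ _ Ht')) as (Hs & _ & Hx).
  apply piece_sym in Hx; destruct Hx as [Hadm Hchain].
  replace w with (nth K (x1 ++ [w]) (a O)) by (rewrite <- Hlen; apply nth_middle).
  apply (adherent_chain r lam1) with (4 := Hchain); [easy|easy|exists K].
  apply suffix_length in Hs; rewrite <- branch_length in Hs; cbn [length] in Hs |- *.
  rewrite (nth_firstn_indep _ _ _ _ (a O)), dist_sym by lia.
  apply (Hlt' K), le_n.
Qed.
End GenericBranch.

(** * Isomorphism from matching dense sequences *)

Definition same_limit {L} {M N : structure L} (a : nat -> M) (b : nat -> N) (x : M) (y : N)
    : Prop := forall e, 0 < e -> exists i, dist M (a i) x < e /\ dist N (b i) y < e.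

Lemma same_limit_sym {L} {M N : structure L} (a : nat -> M) (b : nat -> N) x y :
  same_limit a b x y -> same_limit b a y x.
Proof. intros Hxy e He; destruct (Hxy e He) as [i []]; now exists i. Qed.

Lemma same_limit_exists {L} {M N : structure L} {preM : prestructure M} (a : nat -> M)
    (b : nat -> N) : polish N -> dense_family a ->
  (forall i j, dist M (a i) (a j) = dist N (b i) (b j)) ->
  forall x, exists y, same_limit a b x y.
Proof.
  intros HN Ha Hab x.
  destruct (choice (fun k i => dist M (a i) x < eps k)) as [s Hs].
  { intros k; apply Ha, eps_pos. }
  destruct (polish_complete N (fun k => b (s k)) HN) as [y Hy].
  { intros e He; destruct (eventually_eps_lt (e / 2) ltac:(lra)) as [K HK].
    exists K; intros k k' Hk Hk'; rewrite <- Hab.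
    pose proof (Hs k); pose proof (Hs k') as Hs'; rewrite dist_sym in Hs'.
    pose proof (dist_triangle (a (s k)) x (a (s k'))).
    pose proof (HK k Hk); pose proof (HK k' Hk'); lra. }
  exists y; intros e He; destruct (eventually_and_ex _ _ (Hy e He) (eventually_eps_lt e He))
    as (k & Hk & Hke).
  exists (s k); split; [specialize (Hs k); lra|easy].
Qed.

Section Extension.
Context {L : signature} {M N : structure L} {polishM : polish M} {polishN : polish N}.
Context (a : nat -> M) (b : nat -> N).
Context (Ha : dense_family a) (Hb : dense_family b).
Context (Hab : forall α, atom_value M a α = atom_value N b α).

Lemma atom_value_same_limit {I} (s : I -> M) (s' : I -> N) α :
  (forall i, same_limit a b (s i) (s' i)) -> atom_value M s α = atom_value N s' α.
Proof.
  intros Hs; apply cond_eq; intros e He.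
  destruct (eventually_and_ex _ _
    (atom_value_continuous (M := M) α (e / 2) ltac:(lra))
    (atom_value_continuous (M := N) α (e / 2) ltac:(lra))) as (n & HM & HN).
  destruct (choice (fun i k => dist M (a k) (s i) < eps n /\ dist N (b k) (s' i) < eps n))
    as [σ Hσ]; [intros i; apply Hs, eps_pos|].
  specialize (HM (fun i => a (σ i)) s (fun i _ => proj1 (Hσ i))).
  specialize (HN (fun i => b (σ i)) s' (fun i _ => proj2 (Hσ i))).
  rewrite <- atom_value_map, Hab in HM; rewrite <- atom_value_map in HN.
  apply Rabs_def2 in HM; apply Rabs_def2 in HN; apply Rabs_def1; lra.
Qed.

Lemma isomorphic_of_dense : isomorphic M N.
Proof.
  assert (Hdist : forall i j, dist M (a i) (a j) = dist N (b i) (b j))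
    by (intros i j; exact (Hab (DistAtom i j))).
  destruct (choice _ (same_limit_exists a b polishN Ha Hdist)) as [g Hg]; exists g.
  assert (Hvalue : forall α, atom_value N g α = atom_value M (fun x => x) α)
    by (intros α; symmetry; now apply atom_value_same_limit).
  split; [|split].
  - intros y; destruct (same_limit_exists b a polishM Hb (fun i j => eq_sym (Hdist i j)) y)
      as [x Hx]; exists x; apply same_limit_sym in Hx.
    pose proof polishN as (_ & Hsep & _); apply Hsep.
    rewrite <- (dist_refl x); symmetry.
    apply (atom_value_same_limit (fun _ => x) (fun i : bool => if i then g x else y)
      (DistAtom true false)); now intros [].
  - intros x y; exact (Hvalue (DistAtom x y)).
  - intros P v; exact (Hvalue (PredAtom P v)).
Qed.
End Extension.

(** * The back-and-forth game *)

Record back_and_forth {L} (M N : structure L)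
    (G : list (label L) -> list M -> list N -> Prop) : Prop := {
  bf_root : G [] [] [];
  bf_valid : forall lam x y, G lam x y -> piece M lam x x /\ piece N lam y y;
  bf_piece : forall lam x y x' y',
    G lam x y -> piece M lam x x' -> piece N lam y y' -> G lam x' y';
  bf_forth : forall l lam x y x', G lam x y -> below M lam x (l :: lam) x' ->
    exists y', below N lam y (l :: lam) y' /\ G (l :: lam) x' y';
  bf_back : forall l lam x y y', G lam x y -> below N lam y (l :: lam) y' ->
    exists x', below M lam x (l :: lam) x' /\ G (l :: lam) x' y' }.

Lemma back_and_forth_flip {L} (M N : structure L) G :
  back_and_forth M N G -> back_and_forth N M (fun lam y x => G lam x y).
Proof.
  intros [Hroot Hvalid Hpiece Hforth Hback]; split; [easy| | | |].
  - intros lam y x Hxy; now apply and_comm, Hvalid.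
  - intros lam y x y' x' Hxy Hy Hx; now apply (Hpiece lam x y).
  - intros l lam y x y' Hxy; now apply Hback.
  - intros l lam y x x' Hxy; now apply Hforth.
Qed.

Lemma bf_below {L} {M N : structure L} {preM : prestructure M} {preN : prestructure N} G
    lam x y lam' x' : back_and_forth M N G -> G lam x y -> below M lam x lam' x' ->
  exists y', below N lam y lam' y' /\ G lam' x' y'.
Proof.
  intros HG Hxy ([mu ->] & Hx' & Hxx'); revert x' Hx' Hxx'.
  induction mu as [|l mu IH]; intros x' Hx' Hxx'; simpl in *.
  - pose proof (piece_length_l _ _ _ Hx') as Hlen; rewrite firstn_all2 in Hxx' by lia.
    destruct (bf_valid _ _ _ HG _ _ _ Hxy) as [_ Hy].
    exists y; split; [eapply below_refl, Hy|now apply (bf_piece _ _ _ HG _ x y)].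
  - pose proof (below_child _ _ _ Hx') as Hb.
    destruct (IH (firstn (length (mu ++ lam)) x')) as [y1 [Hy1 HG1]].
    + now apply piece_parent in Hx'.
    + rewrite firstn_firstn, length_app, Nat.min_l by lia; exact Hxx'.
    + destruct (bf_forth _ _ _ HG _ _ _ _ _ HG1 Hb) as [y2 [Hy2 HG2]].
      exists y2; split; [now apply below_trans with (1 := Hy1)|exact HG2].
Qed.

Record game_position {L} (M N : structure L) (G : list (label L) -> list M -> list N -> Prop)
    (t : nat) (lam : list (label L)) (x : list M) (y : list N) (n : nat) : Prop := {
  game_position_settled_le : (n <= length lam)%nat;
  game_position_related : G lam x y;
  game_position_stable_l : exists d, (t <= d)%nat /\ stable (M := M) n d lam x;
  game_position_stable_r : exists d, (t <= d)%nat /\ stable (M := N) n d lam y }.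

Record game_move {L} {M N : structure L} (t : nat) (lam : list (label L)) (x : list M) (y : list N)
    (n : nat) (lam' : list (label L)) (x' : list M) (y' : list N) : Prop := {
  game_move_length : (length lam < length lam')%nat;
  game_move_below_l : below M lam x lam' x';
  game_move_below_r : below N lam y lam' y';
  game_move_close_l : close_upto M n (eps t) x x';
  game_move_close_r : close_upto N n (eps t) y y' }.

Lemma game_position_flip {L} (M N : structure L) G t lam x y n : game_position M N G t lam x y n ->
  game_position N M (fun lam y x => G lam x y) t lam y x n.
Proof. now intros []; split. Qed.

Lemma game_move_flip {L} (M N : structure L) t lam (x : list M) (y : list N) n lam' x' y' :
  game_move t lam x y n lam' x' y' -> game_move t lam y x n lam' y' x'.
Proof. now intros []; split. Qed.

Lemma stable_recentre {L} {M : structure L} n d t lam x lam' x' :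
  (t <= d)%nat -> stable (M := M) n d lam x -> piece M lam x x -> below M lam x lam' x' ->
  exists x'', piece M lam' x' x'' /\ close_upto M n (eps t) x x''.
Proof.
  intros Ht HS Hx Hx'; destruct (HS lam' x' Hx' x Hx) as (x'' & Hx'' & Hc).
  exists x''; split; [easy|]; apply close_mono with (2 := Hc); now apply eps_le.
Qed.

Lemma game_move_exists {L} (M N : structure L) {preM : prestructure M} {preN : prestructure N}
    (a : nat -> M) (b : N) G τ t lam x y n :
  almost_locally_totally_bounded M -> almost_locally_totally_bounded N ->
  back_and_forth M N G -> game_position M N G t lam x y n ->
  exists lam' x' y', game_position M N G (S t) lam' x' y' (length lam) /\
    game_move t lam x y n lam' x' y' /\ task_done a τ x lam' x'.
Proof.
  intros HM HN HG [Hn Hxy (dx & Htx & Sx) (dy & Hty & Sy)].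
  destruct (bf_valid _ _ _ HG _ _ _ Hxy) as [Hx Hy].
  pose proof (back_and_forth_flip _ _ _ HG) as HG'.
  destruct (task_done_exists a τ lam x HM Hx) as (lam1 & x1 & Bx1 & Hdone).
  pose proof (below_length _ _ _ _ Bx1) as Hlen1.
  destruct (stable_below_exists (a O) lam1 x1 (length lam) (S t))
    as (d2 & lam2 & x2 & Hd2 & Bx12 & Hlen2 & S2); [easy|apply Bx1|easy|].
  pose proof (below_trans _ _ _ _ _ _ Bx1 Bx12) as Bx2.
  destruct (bf_below G _ _ _ _ _ HG Hxy Bx2) as (y2 & By2 & G2).
  destruct (stable_below_exists b lam2 y2 (length lam) (S t))
    as (d3 & lam3 & y3 & Hd3 & By23 & Hlen3 & S3); [easy|apply By2|lia|].
  pose proof (below_trans _ _ _ _ _ _ By2 By23) as By3.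
  destruct (bf_below _ _ _ _ _ _ HG' G2 By23) as (x3 & Bx23 & G3).
  pose proof (below_trans _ _ _ _ _ _ Bx2 Bx23) as Bx3.
  destruct (stable_recentre _ _ _ _ _ _ _ Htx Sx Hx Bx3) as (x4 & Px4 & Cx4).
  destruct (stable_recentre _ _ _ _ _ _ _ Hty Sy Hy By3) as (y4 & Py4 & Cy4).
  pose proof (below_piece_r _ _ _ _ _ Bx23 Px4) as Bx24.
  exists lam3, x4, y4; split; [|split].
  - split; [lia|now apply (bf_piece _ _ _ HG _ x3 y3)|exists d2|exists d3]; (split; [easy|]).
    + apply stable_below with (2 := S2); [lia|easy].
    + apply stable_below with (2 := S3); [lia|eapply below_refl, Py4].
  - split; [lia|now apply below_piece_r with x3|now apply below_piece_r with y3|easy|easy].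
  - apply task_done_below with (1 := Hdone); now apply below_trans with lam2 x2.
Qed.

Section Game.
Context {L : signature} {M N : structure L} {polishM : polish M} {polishN : polish N}.
Context (a : nat -> M) (b : nat -> N).
Context (HM : almost_locally_totally_bounded M) (HN : almost_locally_totally_bounded N).
Context {G : list (label L) -> list M -> list N -> Prop} (HG : back_and_forth M N G).

Lemma countable_side_task : countable (bool * task L).
Proof.
  apply countable_prod; [|apply countable_task].
  exists (fun s : bool => if s then 1%nat else O); now intros [] [].
Qed.

Definition task_done_on_side (task : bool * task L) (x : list M) (y : list N)
    (lam' : list (label L)) (x' : list M) (y' : list N) : Prop :=
  let (left, τ) := task in if left then task_done a τ x lam' x' else task_done b τ y lam' y'.

Lemma play_exists (schedule : nat -> bool * task L) :
  exists (lam : nat -> list (label L)) x y (n : nat -> nat), forall t,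
    game_position M N G t (lam t) (x t) (y t) (n t) /\ n (S t) = length (lam t) /\
    game_move t (lam t) (x t) (y t) (n t) (lam (S t)) (x (S t)) (y (S t)) /\
    task_done_on_side (schedule t) (x t) (y t) (lam (S t)) (x (S t)) (y (S t)).
Proof.
  destruct (dependent_choice
    (fun t '(lam, x, y, n) => game_position M N G t lam x y n)
    (fun t '(lam, x, y, n) '(lam', x', y', n') => n' = length lam /\
      game_move t lam x y n lam' x' y' /\ task_done_on_side (schedule t) x y lam' x' y'))
    as [s Hs].
  - exists ([], [], [], O); split; [easy|apply (bf_root _ _ _ HG)|exists O|exists O];
      (split; [easy|apply stable_0]).
  - intros t [[[lam x] y] n] Hpos; destruct (schedule t) as [[] τ].
    + destruct (game_move_exists M N a (b O) G τ t lam x y n HM HN HG Hpos)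
        as (lam' & x' & y' & Hpos' & Hmove & Hdone).
      now exists (lam', x', y', length lam).
    + destruct (game_move_exists N M b (a O) _ τ t lam y x n HN HM (back_and_forth_flip _ _ _ HG)
        (game_position_flip _ _ _ _ _ _ _ _ Hpos)) as (lam' & y' & x' & Hpos' & Hmove & Hdone).
      exists (lam', x', y', length lam); split; [now apply game_position_flip in Hpos'|].
      split; [easy|]; split; [now apply game_move_flip|easy].
  - exists (fun t => fst (fst (fst (s t)))), (fun t => snd (fst (fst (s t)))).
    exists (fun t => snd (fst (s t))), (fun t => snd (s t)).
    intros t; specialize (Hs t); now destruct (s t) as [[[] ] ], (s (S t)) as [[[] ] ].
Qed.

Lemma generic_branches_exist :
  exists lam x y n, generic_branch a lam x n /\ generic_branch b lam y n.
Proof.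
  set (schedule := countable_enumeration (true, Decide (DistAtom O O) O) countable_side_task).
  destruct (play_exists (enum schedule)) as (lam & x & y & n & Hplay).
  assert (Hsched : forall left τ T, exists t, (T <= t)%nat /\
    task_done_on_side (left, τ) (x t) (y t) (lam (S t)) (x (S t)) (y (S t))).
  { intros left τ T; set (t := index schedule (left, τ) T); exists t; split; [apply index_ge|].
    destruct (Hplay t) as (_ & _ & _ & Hdone); unfold t in Hdone at 1.
    now rewrite enum_index in Hdone. }
  exists lam, x, y, n; split; (split; try (intros t; apply (Hplay t))).
  - apply (Hsched true).
  - apply (Hsched false).
Qed.

Lemma branch_atom_value_eq lam x y n l r : generic_branch a lam x n -> generic_branch b lam y n ->
  (forall i t, (i < n t)%nat -> dist M (nth i (x t) (a O)) (l i) <= 2 * eps t) ->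
  (forall i t, (i < n t)%nat -> dist N (nth i (y t) (b O)) (r i) <= 2 * eps t) ->
  forall α, atom_value M l α = atom_value N r α.
Proof.
  intros Hx Hy Hl Hr α; apply cond_eq; intros e He.
  destruct (exists_eps_lt (e / 4) ltac:(lra)) as [c Hc].
  destruct (atom_uses_bounded α) as [K HK].
  destruct (eventually_settled a Hx K) as [T HT].
  destruct (branch_done _ _ _ _ Hx (Decide α c) T) as (t & Ht & lam1 & z & Hlen & Hs).
  assert (Huses : forall i, atom_uses α i -> (i < length lam1)%nat).
  { intros i Hi; pose proof (HT t Ht); pose proof (branch_settled_le _ _ _ _ Hx t).
    rewrite (branch_length a Hx) in Hlen; pose proof (HK K (le_n K) i Hi); lia. }
  destruct (eventually_and_ex _ _ (eventually_ge (S t)) (filter_and (F := eventually) _ _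
    (eventually_atom_limit a Hx Hl α (e / 4) ltac:(lra))
    (eventually_atom_limit b Hy Hr α (e / 4) ltac:(lra)))) as (t' & Ht' & Hxl & Hyr).
  pose proof (suffix_trans _ _ _ Hs (proj1 (branch_below_le a Hx _ _ Ht'))) as Hs'.
  pose proof (near_dist _ _ _ _ (branch_value a Hx α z c lam1 t' Hs' Huses)
    (branch_value b Hy α z c lam1 t' Hs' Huses)) as Hxy.
  apply Rabs_def2 in Hxl, Hyr, Hxy; apply Rabs_def1; lra.
Qed.

Lemma back_and_forth_isomorphic :
  dense_family a -> dense_family b -> isomorphic M N.
Proof.
  intros Ha Hb; destruct generic_branches_exist as (lam & x & y & n & Hx & Hy).
  destruct (branch_limit a Hx) as [l Hl]; destruct (branch_limit b Hy) as [r Hr].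
  apply (isomorphic_of_dense l r).
  - now apply (branch_dense a Hx Hl).
  - now apply (branch_dense b Hy Hr).
  - now apply (branch_atom_value_eq lam x y n).
Qed.
End Game.

(** * Isomorphic trees come from isomorphic structures *)

Section Recovery.
Context {L : signature}.

Definition corresponding {M N : structure L} (f : nat -> M) (g : nat -> N) (p : nat -> nat)
    (lam : list (label L)) (x : list M) (y : list N) : Prop :=
  exists m, labels m = lam /\ labels (p m) = lam /\
    piece M lam x (map f (tuple L m)) /\ piece N lam y (map g (tuple L (p m))).

Lemma corresponding_inverse {M N : structure L} (f : nat -> M) (g : nat -> N) p q lam x y :
  (forall m, q (p m) = m) -> corresponding f g p lam x y -> corresponding g f q lam y x.
Proof. intros Hqp (m & E & E' & Hx & Hy); exists (p m); now rewrite Hqp. Qed.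

Section Forth.
Context {M N : structure L} {preM : prestructure M} {preN : prestructure N}.
Context {c c' : Code L} {f : nat -> M} {g : nat -> N}.
Context (Hf : dense_embedding (code_structure c) M f).
Context (Hg : dense_embedding (code_structure c') N g).
Context {p : nat -> nat}.
Context (Hlabelled : forall lam m, labelled c lam m -> labelled c' lam (p m)).
Context (Hchild : forall m m', child c m m' -> child c' (p m) (p m')).

Lemma corresponding_forth l lam (x : list M) (y : list N) x' :
  corresponding f g p lam x y -> below M lam x (l :: lam) x' ->
  exists y', below N lam y (l :: lam) y' /\ corresponding f g p (l :: lam) x' y'.
Proof.
  intros (m & E & E' & Hx & Hy) Hx'.
  destruct (dense_in_piece Hf (l :: lam) x' (proj1 (proj2 Hx'))) as [s Hs].
  set (m' := index (nodes L) (l :: lam, s) O).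
  assert (El : labels m' = l :: lam) by apply labels_index.
  assert (Et : tuple L m' = s) by apply tuple_index.
  assert (Hm' : labelled c (l :: lam) m').
  { split; [easy|]; unfold valid; rewrite El, Et.
    apply (piece_transfer Hf); now apply piece_refl_r in Hs. }
  assert (Hc : child c m m').
  { split; [exists l; congruence|]; rewrite E, El, Et; apply (below_transfer Hf).
    apply below_piece_l with x; [now apply piece_sym|]; now apply below_piece_r with x'. }
  destruct (Hlabelled _ _ Hm') as [El' Hv]; apply Hchild in Hc; destruct Hc as [_ Hc].
  rewrite E', El' in Hc; apply (below_transfer Hg) in Hc.
  exists (map g (tuple L (p m'))); split; [now apply below_piece_l with (1 := Hy)|].
  exists m'; rewrite Et; split; [easy|]; split; [easy|]; split; [easy|apply Hc].
Qed.
End Forth.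

Lemma corresponding_back_and_forth (c c' : Code L) (M N : structure L)
    {preM : prestructure M} {preN : prestructure N} (f : nat -> M) (g : nat -> N) p q :
  dense_embedding (code_structure c) M f -> dense_embedding (code_structure c') N g ->
  (forall m, q (p m) = m) -> (forall m, p (q m) = m) ->
  (forall lam m, labelled c lam m <-> labelled c' lam (p m)) ->
  (forall m m', child c m m' <-> child c' (p m) (p m')) ->
  back_and_forth M N (corresponding f g p).
Proof.
  intros Hf Hg Hqp Hpq Hlabelled Hchild; split.
  - set (m := index (nodes L) ([], []) O); exists m.
    assert (El : labels m = []) by apply labels_index.
    assert (Et : tuple L m = []) by apply tuple_index.
    destruct (proj1 (Hlabelled [] m)) as [El' Hv].
    { split; [easy|]; unfold valid; now rewrite El, Et. }
    unfold valid in Hv; rewrite El' in Hv; destruct Hv as [Et' _].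
    now rewrite El, El', Et, Et'.
  - intros lam x y (m & _ & _ & Hx & Hy); split; eapply piece_refl_l; eassumption.
  - intros lam x y x' y' (m & E & E' & Hx & Hy) Hx' Hy'; exists m.
    split; [easy|]; split; [easy|]; split.
    + apply piece_trans with x; [now apply piece_sym|easy].
    + apply piece_trans with y; [now apply piece_sym|easy].
  - intros l lam x y x'; apply (corresponding_forth Hf Hg); [apply Hlabelled|apply Hchild].
  - intros l lam x y y' Hxy Hy'; apply (corresponding_inverse _ _ _ _ _ _ _ Hqp) in Hxy.
    destruct (corresponding_forth Hg Hf (p := q)) with (3 := Hxy) (4 := Hy')
      as (x' & Hx' & Hyx').
    + intros lam' m Hm; apply Hlabelled; now rewrite Hpq.
    + intros m m' Hm; apply Hchild; now rewrite !Hpq.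
    + exists x'; split; [easy|]; now apply (corresponding_inverse _ _ _ _ _ _ _ Hpq).
Qed.

Lemma ciso_isomorphic (c c' : Code L) (M N : structure L) a b :
  codes c M a -> codes c' N b -> almost_locally_compact M -> almost_locally_compact N ->
  ciso (classify c) (classify c') -> isomorphic M N.
Proof.
  intros Hc Hc' AM AN (p & q & Hqp & Hpq & Hlabelled & Hchild)%ciso_classify.
  pose proof (proj1 Hc) as polishM; pose proof (proj1 Hc') as polishN.
  pose proof (codes_dense_embedding c M a Hc) as Ha.
  pose proof (codes_dense_embedding c' N b Hc') as Hb.
  apply back_and_forth_isomorphic with (a := a) (b := b) (G := corresponding a b p).
  - now apply almost_locally_compact_totally_bounded.
  - now apply almost_locally_compact_totally_bounded.
  - now apply (corresponding_back_and_forth c c' M N a b p q).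
  - apply (embedding_dense _ _ _ Ha).
  - apply (embedding_dense _ _ _ Hb).
Qed.
End Recovery.

Theorem theorem3p6 (L : signature) (F T : formula L -> Prop) :
  fragment F -> F_theory F T ->
  (forall M : structure L, models M T -> almost_locally_compact M) ->
  classifiable_by_countable_structures (ModT T) (@isoT L).
Proof.
  intros _ _ Halc; exists tree_language, classify; split.
  - intros B HB; exists (fun c => B (classify c)); split; [now apply classify_borel|easy].
  - intros c c' (M & a & Hc & HMT) (N & b & Hc' & HNT); split; [apply isoT_ciso|].
    intros Hciso; exists M, N, a, b; split; [easy|]; split; [easy|].
    apply (ciso_isomorphic c c' M N a b); auto.
Qed.
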